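(* Let $1\le t\le m$ and $s\in\mathbb{N}$. The ideal $I_t^{(s)}$ is an ideal of standard monomials. In particular, the set of the standard monomials $\mu$ with $\gamma_t(\mu)\geq s$ is a $\mathbb{K}$-basis of $I_t^{(s)}$. Furthermore, $G_{t,s}$ is a Gröbner basis of $I_t^{(s)}$, where $G_{t,s}$ denotes the set of the standard monomials $\mu$ all of whose factors have size $\geq t$ and such that $\gamma_t(\mu)=s$.
   Context: Let $\mathbb{K}$ be a field, let $n\ge 1$ and $c\geq 1$ be integers, and let $R=\mathbb{K}[x_1,\dots,x_n]$ with the degree lexicographic order $<$ induced by $x_1>x_2>\cdots>x_n$; Gröbner bases are with respect to this order. Set $m=\lfloor \frac{n+c}{c+1}\rfloor$. For $1\le t\le m$ let $X_t$ be the $t\times (n-(t-1)c)$ matrix whose $(i,j)$ entry is $x_{j+(i-1)c}$, and let $I_t\subset R$ be the ideal generated by all $t$-minors of $X_t$. Each $I_t$ is prime, and $I^{(s)}=R\cap I^sR_I$ denotes the $s$th symbolic power of a prime ideal $I$. A sequence $a_1,\dots,a_s$ in $\{1,\dots,n\}$ is a $c$-chain if $a_i+c<a_{i+1}$ for all $i<s$; the monomial $x_{a_1}\cdots x_{a_s}$ is then also called a $c$-chain (of length $s$). For a $c$-chain, $M(a_1,\dots,a_s)$ denotes the $s$-minor of $X_s$ whose main diagonal entries are $x_{a_1},\dots,x_{a_s}$ (it uses columns $a_1,a_2-(c+1),\dots,a_s-(s-1)(c+1)$). The $c$-decomposition of a monomial $\delta$ is the factorization $\delta=\delta_1\delta_2\cdots\delta_k$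 obtained by letting $\delta_1$ be the $c$-chain dividing $\delta$ that is maximal with respect to $<$, then $\delta_2$ the maximal $c$-chain dividing $\delta/\delta_1$, and so on. If $\delta_i=x_{a_{i1}}\cdots x_{a_{is_i}}$, put $\Phi(\delta)=\prod_{i=1}^k M(a_{i1},\dots,a_{is_i})$. The standard monomials are the polynomials $\Phi(\delta)$, $\delta$ ranging over the monomials of $R$; the minors $M(a_{i1},\dots,a_{is_i})$ are the factors of the standard monomial, of size $s_i$. For such a product of minors $\mu$ with sizes $s_1,\dots,s_k$, set $\gamma_t(\mu)=\sum_{i=1}^k\max\{s_i-t+1,0\}$. An ideal of $R$ is an ideal of standard monomials if it has a $\mathbb{K}$-vector space basis consisting of standard monomials. *)

(* Defs.v *)
From mathcomp Require Import all_boot all_order all_algebra.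
From mathcomp Require Import mpoly.

Set Implicit Arguments.
Unset Strict Implicit.
Unset Printing Implicit Defensive.

Import Order.TTheory GRing.Theory.
Local Open Scope ring_scope.

(** * Ideals, symbolic powers, bases *)

Section Ideals.
Variable A : comNzRingType.
Implicit Types (I S : A -> Prop) (f : A).

Definition is_ideal I : Prop :=
  [/\ I 0, forall f g, I f -> I g -> I (f + g) & forall r f, I f -> I (r * f)].

Definition ideal_gen S f : Prop :=
  exists (k : nat) (r g : 'I_k -> A),
    (forall i, S (g i)) /\ f = \sum_(i < k) r i * g i.

Definition ideal_pow I (s : nat) : A -> Prop :=
  ideal_gen (fun p => exists2 g : 'I_s -> A,
    forall i, I (g i) & p = \prod_(i < s) g i).

End Ideals.

Section SymbolicPower.
Variable A : idomainType.
Implicit Types (I : A -> Prop).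

(* The localization A_I at a prime I, as a subring of the fraction field. *)
Definition localization I (x : {fraction A}) : Prop :=
  exists a b : A, ~ I b /\ x = tofrac a / tofrac b.

(* The extension J A_I of an ideal J of A to the localization A_I. *)
Definition extend_loc I (J : A -> Prop) (x : {fraction A}) : Prop :=
  exists (k : nat) (r : 'I_k -> {fraction A}) (g : 'I_k -> A),
    [/\ forall i, localization I (r i), forall i, J (g i)
      & x = \sum_(i < k) r i * tofrac (g i)].

Definition symbolic_power I (s : nat) (f : A) : Prop :=
  extend_loc I (ideal_pow I s) (tofrac f).

End SymbolicPower.

Section Bases.
Variables (K : fieldType) (V : lmodType K).
Implicit Types (S W : V -> Prop).

Definition in_span S (v : V) : Prop :=
  exists (k : nat) (a : 'I_k -> K) (g : 'I_k -> V),
    (forall i, S (g i)) /\ v = \sum_(i < k) a i *: g i.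

Definition lin_indep S : Prop :=
  forall (k : nat) (a : 'I_k -> K) (g : 'I_k -> V),
    injective g -> (forall i, S (g i)) ->
    \sum_(i < k) a i *: g i = 0 -> forall i, a i = 0.

Definition is_basis S W : Prop :=
  lin_indep S /\ forall v, W v <-> in_span S v.

End Bases.

(** * Groebner bases *)

(* The order [(m1 <= m2)%O] on ['X_{1..n}], with respect to which [mlead] is
   taken, compares [mdeg m :: m] lexicographically. Despite the name degrevlex
   in the header of mpoly.v, it is thus the degree lexicographic order with
   'X_0 > 'X_1 > ..., as the next lemma records. *)
Lemma deglexP (n : nat) (m1 m2 : 'X_{1..n}) :
  (m1 < m2)%O <->
  (mdeg m1 < mdeg m2)%N \/
  mdeg m1 = mdeg m2 /\
  exists i : 'I_n, (forall j : 'I_n, (j < i)%N -> m1 j = m2 j)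
                   /\ (m1 i < m2 i)%N.
Proof.
split=> [lt12 | [/lt_mdeg_ltmc //|[eq12 [i [eqj lti]]]]]; last first.
  by apply/(ltmcP eq12); exists i.
have := lemc_mdeg (ltW lt12); rewrite leq_eqVlt => /orP[/eqP eq12|]; last by left.
by right; split=> //; have [i eqj lti] := ltmcP eq12 lt12; exists i.
Qed.

Section Groebner.
Variables (K : fieldType) (n : nat).
Implicit Types (G I : {mpoly K[n]} -> Prop).

(* The ideal generated by the leading monomials of the nonzero elements. *)
Definition initial_ideal G : {mpoly K[n]} -> Prop :=
  ideal_gen (fun p => exists2 f, G f /\ f != 0 & p = 'X_[mlead f]).

Definition groebner_basis G I : Prop :=
  [/\ exists l : seq {mpoly K[n]}, forall g, G g -> g \in l,
      forall g, G g -> I g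
    & forall f, initial_ideal I f <-> initial_ideal G f].

End Groebner.

(** * The matrices X_t and the ideals I_t *)

Lemma hankel_subproof (n c t : nat) (i : 'I_t) (j : 'I_(n - t.-1 * c)) :
  (j + i * c < n)%N.
Proof.
have le_ic : (i * c <= t.-1 * c)%N.
  by rewrite leq_mul2r -ltnS (ltn_predK (ltn_ord i)) ltn_ord orbT.
by rewrite (leq_ltn_trans (leq_add (leqnn _) le_ic)) // addnC -ltn_subRL.
Qed.

(* Indices start at 0, here and below: the variables are 'X_0, ..., 'X_(n-1). *)
Definition hankel (K : fieldType) (n c t : nat) :
    'M[{mpoly K[n]}]_(t, n - t.-1 * c) :=
  \matrix_(i, j) 'X_(Ordinal (hankel_subproof i j)).

Definition hankel_ideal (K : fieldType) (n c t : nat) : {mpoly K[n]} -> Prop :=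
  ideal_gen (fun p => exists2 f : 'I_t -> 'I_(n - t.-1 * c),
    {homo f : i j / (i < j)%N} & p = \det (colsub f (hankel K n c t))).

Arguments hankel_ideal K n c t p : clear implicits.

(** * Chains and standard monomials *)

Definition c_chain (n c : nat) (a : seq 'I_n) : bool :=
  sorted (fun i j : 'I_n => (i + c < j)%N) a.

Definition chain_mnm (n : nat) (a : seq 'I_n) : 'X_{1..n} :=
  (\sum_(i <- a) U_(i))%MM.

(* The minor of X_s, s = size a, whose main diagonal is 'X_a_0, ..., 'X_a_(s-1).
   If [a] is a c-chain, the columns f exist and are unique: f i = a_i - i * c.
   The value 0 is only taken on sequences that are not c-chains. *)
Definition chain_minor (K : fieldType) (n c : nat) (a : seq 'I_n) :
    {mpoly K[n]} :=
  let X := hankel K n c (size a) in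
  if [pick f : {ffun 'I_(size a) -> 'I_(n - (size a).-1 * c)}
       | [forall i, X i (f i) == 'X_(tnth (in_tuple a) i)]] is Some f
  then \det (colsub f X) else 0.

(* [a] is the largest c-chain dividing [d]. *)
Definition max_chain (n c : nat) (d : 'X_{1..n}) (a : seq 'I_n) : Prop :=
  [/\ c_chain c a, (chain_mnm a <= d)%MM
    & forall b, c_chain c b -> (chain_mnm b <= d)%MM ->
        (chain_mnm b <= chain_mnm a)%O].

(* [c_decomposition c d l]: the c-decomposition of [d] has factors [l]. *)
Inductive c_decomposition (n c : nat) : 'X_{1..n} -> seq (seq 'I_n) -> Prop :=
| c_decomposition_nil : c_decomposition c 0%MM [::]
| c_decomposition_cons (d : 'X_{1..n}) (a : seq 'I_n) (l : seq (seq 'I_n)) :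
    d != 0%MM -> max_chain c d a ->
    c_decomposition c (d - chain_mnm a)%MM l ->
    c_decomposition c d (a :: l).

(* [Phi d] is [chain_minors K c l] when the c-decomposition of [d] is [l]. *)
Definition chain_minors (K : fieldType) (n c : nat) (l : seq (seq 'I_n)) :
    {mpoly K[n]} :=
  \prod_(a <- l) chain_minor K c a.

(* [p] is a standard monomial such that the chains [l] defining its factors
   satisfy [P]. *)
Definition standard_monomial_with (K : fieldType) (n c : nat)
    (P : seq (seq 'I_n) -> Prop) (p : {mpoly K[n]}) : Prop :=
  exists (d : 'X_{1..n}) (l : seq (seq 'I_n)),
    [/\ c_decomposition c d l, P l & p = chain_minors K c l].

Definition standard_monomial (K : fieldType) (n c : nat) :
    {mpoly K[n]} -> Prop :=
  standard_monomial_with c (fun=> True).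

(* max (s_i - t + 1, 0) is the truncated difference s_i + 1 - t. *)
Definition gamma (n t : nat) (l : seq (seq 'I_n)) : nat :=
  (\sum_(a <- l) ((size a).+1 - t))%N.

Definition ideal_of_standard_monomials (K : fieldType) (n c : nat)
    (I : {mpoly K[n]} -> Prop) : Prop :=
  is_ideal I /\
  exists S : {mpoly K[n]} -> Prop,
    (forall p, S p -> standard_monomial c p) /\ is_basis S I.

Definition groebner_set (K : fieldType) (n c t s : nat) : {mpoly K[n]} -> Prop :=
  standard_monomial_with c
    (fun l => all (fun a => (t <= size a)%N) l /\ gamma t l = s).

(* Main.v *)
From HB Require Import structures.
Require Import Defs.
From mathcomp Require Import all_boot all_order all_algebra.
From mathcomp Require Import perm zify ring.
From mathcomp Require Import mpoly.

(** Let T = t - 1 and let W_s be the ideal of the polynomials f such that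
    f (p + eps q) vanishes to order s in eps, where p is a sum of T generic points
    of the rational normal scroll defined by the 2-minors, and q is a generic
    point of the affine space. Writing J_s for the span of the standard monomials
    with gamma_t >= s, one proves J_s <= I_t^(s) <= W_s <= J_s.

    - W_s <= J_s. If the leading monomial u of f has gamma_t = g, then T intervals
      [b, b + c] cover all but g of the factors of u (a theorem of Greene type for
      the greedy c-decomposition). A monomial supported in such an interval is
      standard for the scroll, so it is minimal among the monomials with the same
      image. Extracting, for every interval, the coefficient of the corresponding
      part of u in f (p + eps q) leaves a term of order at most g in eps. Hence
      f in W_s forces g >= s, and one subtracts a multiple of the standard
      monomial with leading monomial u.
    - For s = 1 this gives I_t = J_1 = W_1, which is the prime ideal of the
      generic point p. As eps is a prime element, I_t^(s) <= W_s follows.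
    - J_s <= I_t^(s). By the Schur complement, a minor of size T + k times the k-th
      power of its leading T-minor h is h times a k-minor of bordered t-minors,
      which vanish at p, while h does not. *)

Set Implicit Arguments.
Unset Strict Implicit.
Unset Printing Implicit Defensive.

Import Order.TTheory GRing.Theory.
Local Open Scope ring_scope.

(** * Covering by windows *)

Lemma gap_trans (c : nat) : transitive (fun i j => j + c < i)%N.
Proof. move=> j i k; lia. Qed.

Definition in_windows (c : nat) (bs : seq nat) (x : nat) : bool :=
  has (fun b => b <= x <= b + c)%N bs.

Lemma in_windows_cat c bs1 bs2 x :
  in_windows c (bs1 ++ bs2) x = in_windows c bs1 x || in_windows c bs2 x.
Proof. exact: has_cat. Qed.

Lemma count_in_windows_cons c b bs r :
  (count (in_windows c bs) r <= count (in_windows c (b :: bs)) r)%N.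
Proof. by apply: sub_count => x; rewrite /= => ->; rewrite orbT. Qed.

(* By induction on the decreasing chain r = a :: a2 :: _. A window that reaches a
   meets S only in [a2, a2 + c] and [a, a + c]; so one such window can be made to
   contain a, and two or more of them can be replaced by these two windows. *)
Lemma realign_windows (c : nat) (S : pred nat) (r bs : seq nat) :
    sorted (fun i j => j + c < i)%N r -> (forall x, S x -> in_windows c r x) ->
  exists bs', [/\ (size bs' <= size bs)%N,
    forall x, S x -> in_windows c bs x -> in_windows c bs' x
    & (size bs' <= count (in_windows c bs') r)%N].
Proof.
elim: r S bs => [|a r IH] S bs; first by move=> _ H; exists [::]; split=> // x /H.
rewrite /= (path_sortedE (@gap_trans c)) => /andP[/allP lt_r sr] cov.
pose lo := [seq b <- bs | b + c < a]%N; pose hi := [seq b <- bs | a <= b + c]%N.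
have sz_bs : (size bs = size lo + size hi)%N.
  rewrite !size_filter -(count_predC (fun b => b + c < a)%N); congr addn.
  by apply: eq_count => b /=; lia.
have bs_lohi x : in_windows c bs x -> in_windows c lo x \/ in_windows c hi x.
  move=> /hasP[b b_bs xb]; have [lt_ba|le_ab] := ltnP (b + c) a; [left|right];
    by apply/hasP; exists b; rewrite // mem_filter b_bs andbT.
have covr x : S x && (x < a)%N -> in_windows c r x.
  by move=> /andP[/cov /= /orP[|//]]; lia.
have lo_lt x : in_windows c lo x -> (x < a)%N.
  by move=> /hasP[b]; rewrite mem_filter; lia.
have ge_a x : S x -> (a <= x)%N -> (x <= a + c)%N.
  by move=> /cov /= /orP[/andP[]//|/hasP[b /lt_r]]; lia.
have [hi_nil|[b [hi' hi_eq]]] : hi = [::] \/ exists b hi', hi = b :: hi'.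
- by case: (hi) => [|b hi']; [left | right; exists b, hi'].
- have [bs' [sz' cov' cnt']] := IH _ lo sr covr.
  exists bs'; split=> [|x Sx|]; first by rewrite sz_bs; lia.
  + case/bs_lohi=> [lox|]; last by rewrite hi_nil.
    by apply: cov' => //; rewrite Sx lo_lt.
  + by rewrite /=; lia.
have [hi'_nil|hi'_pos] := posnP (size hi').
- have [bs' [sz' cov' cnt']] := IH _ lo sr covr.
  have {}hi_eq : hi = [:: b] by rewrite hi_eq (size0nil hi'_nil).
  have b_hi : (a <= b + c)%N.
    have: b \in hi by rewrite hi_eq mem_head.
    by rewrite mem_filter => /andP[].
  exists (minn a b :: bs'); split=> [|x Sx|].
  + by rewrite sz_bs hi_eq /=; lia.
  + case/bs_lohi=> [lox|]; first by rewrite /= cov' ?orbT // Sx lo_lt.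
    rewrite hi_eq /= orbF; have := ge_a x Sx; lia.
  + have aw : in_windows c (minn a b :: bs') a by rewrite /=; lia.
    apply: (@leq_trans (1 + count (in_windows c bs') r)); first exact: cnt'.
    by rewrite -[1%N]/(true : nat) -aw leq_add2l count_in_windows_cons.
have hi_ge x : in_windows c hi x -> (a <= x + c)%N.
  by move=> /hasP[y]; rewrite mem_filter; lia.
have sz_hi : (1 < size hi)%N by rewrite hi_eq.
case: r => [|a2 r] in IH sr lt_r cov covr *.
  exists [:: a]; split=> [|x Sx _|].
  + by rewrite sz_bs /= (leq_trans _ (leq_addl _ _)) // ltnW.
  + exact: cov.
  + by rewrite /= leqnn leq_addr.
have [bs' [sz' cov' cnt']] := IH _ (a2 :: lo) sr covr.
exists (a :: bs'); split=> [|x Sx xbs|]; first by move: sz'; rewrite sz_bs /=; lia.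
- have [le_ax|lt_xa] := leqP a x; first by rewrite /= le_ax ge_a.
  rewrite [in_windows _ _ _]/= cov' ?orbT ?Sx //=.
  case/bs_lohi: xbs => [->|/hi_ge xa]; first by rewrite orbT.
  have /covr /= /orP[->//|/hasP[b' b'_r]] : S x && (x < a)%N by rewrite Sx.
  move: sr; rewrite /= (path_sortedE (@gap_trans c)) => /andP[/allP lt_r2 _].
  by have := lt_r2 _ b'_r; have := lt_r a2 (mem_head _ _); lia.
- have aw : in_windows c (a :: bs') a by rewrite /=; lia.
  apply: (@leq_trans (1 + count (in_windows c bs') (a2 :: r))); first exact: cnt'.
  by rewrite -[1%N]/(true : nat) -aw leq_add2l count_in_windows_cons.
Qed.

(** The windows saved by realigning are placed at uncovered elements of [r], so that each of them
    covers a new one; any surplus is padded with windows at 0. *)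
Lemma complete_windows (c T : nat) (S : pred nat) (r bs : seq nat) :
    sorted (fun i j => j + c < i)%N r -> (forall x, S x -> in_windows c r x) ->
    size bs = T ->
  exists bs', [/\ size bs' = T,
    forall x, S x -> in_windows c bs x -> in_windows c bs' x
    & (minn T (size r) <= count (in_windows c bs') r)%N].
Proof.
move=> sr cov szT; have [bs' [sz' cov' cnt']] := realign_windows bs sr cov.
pose free := [seq a <- r | ~~ in_windows c bs' a].
pose bs1 := bs' ++ take (T - size bs') free.
pose bs2 := bs1 ++ nseq (T - size bs1) 0%N.
have sz1 : (size bs1 <= T)%N by rewrite size_cat size_take; case: ifP; lia.
exists bs2; split.
- by rewrite size_cat size_nseq subnKC.
- by move=> x Sx /(cov' x Sx); rewrite !in_windows_cat => ->.
have sz_free : (count (in_windows c bs') r + size free = size r)%N.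
  by rewrite size_filter count_predC.
have: (count (in_windows c bs') r + size (take (T - size bs') free) <=
       count (in_windows c bs2) r)%N; last by rewrite size_take; case: ifP; lia.
have uniq_r : uniq r.
  by apply: sorted_uniq sr => [|i]; [exact: gap_trans | lia].
have -> : count (in_windows c bs2) r =
   (count (in_windows c bs') r +
    count (fun x => ~~ in_windows c bs' x && in_windows c bs2 x) r)%N.
  rewrite -(count_predUI (in_windows c bs')) -[LHS]addn0; congr addn.
    by apply: eq_count => x; rewrite /= 2!in_windows_cat; case: (in_windows c bs' x).
  by rewrite (eq_count (a2 := pred0)) ?count_pred0 // => x /=; case: in_windows.
rewrite leq_add2l -size_filter; apply: uniq_leq_size.
  by rewrite take_uniq // filter_uniq.
move=> x x_take; have := mem_take x_take; rewrite !mem_filter => /andP[-> ->].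
rewrite andbT /= !in_windows_cat; apply/orP; left; apply/orP; right.
by apply/hasP; exists x => //; lia.
Qed.

(** * Windows covering the factors of a monomial *)

Section Chains.
Variables (n c : nat).
Implicit Types (a b : seq 'I_n) (d : 'X_{1..n}) (l : seq (seq 'I_n)).

Lemma chain_mnmE a i : chain_mnm a i = count_mem i a.
Proof.
elim: a => [|j a IH]; rewrite /chain_mnm ?big_nil ?mnm0E //.
by rewrite big_cons mnmDE [X in (_ + X)%N]IH mnm1E.
Qed.

Lemma mdeg_chain_mnm a : mdeg (chain_mnm a) = size a.
Proof.
rewrite /chain_mnm mdeg_sum (eq_bigr (fun=> 1%N)) => [|i _]; last exact: mdeg1.
by rewrite sum1_size.
Qed.

Lemma ord_gap_trans : transitive (fun i j : 'I_n => i + c < j)%N.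
Proof. move=> j i k; lia. Qed.

Lemma c_chain_uniq a : c_chain c a -> uniq a.
Proof.
move=> ca; apply: sorted_uniq ca; first exact: ord_gap_trans.
by move=> i; lia.
Qed.

Lemma c_chain_filter (P : pred 'I_n) a : c_chain c a -> c_chain c (filter P a).
Proof. exact/sorted_filter/ord_gap_trans. Qed.

Lemma chain_mnm_dvd a d :
  uniq a -> (chain_mnm a <= d)%MM = all (fun i => d i != 0)%N a.
Proof.
move=> ua; apply/mnm_lepP/allP => [le_ad i ia | nz i].
  by have := le_ad i; rewrite chain_mnmE count_uniq_mem // ia lt0n.
by rewrite chain_mnmE count_uniq_mem //; case: (boolP (i \in a)) => // /nz; lia.
Qed.

(* If no window [a_j, a_j + c] contained x, then inserting x into the chain a,
   or replacing by x the only element of a in [x, x + c], would enlarge a. *)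
Lemma max_chain_windows d a (x : 'I_n) :
  max_chain c d a -> d x != 0%N -> in_windows c (map val a) x.
Proof.
move=> [ca ad amax] dx; rewrite /in_windows has_map; apply/negPn/negP => /hasPn xa.
pose lo := [seq i : 'I_n <- a | i < x]%N; pose hi := [seq i : 'I_n <- a | x + c < i]%N.
pose mid := [seq i : 'I_n <- a | x <= i <= x + c]%N.
have lo_lt i : i \in lo -> (i + c < x)%N.
  by rewrite mem_filter => /andP[ix /xa]/=; lia.
have hi_gt i : i \in hi -> (x + c < i)%N by rewrite mem_filter => /andP[].
have cb : c_chain c (lo ++ x :: hi).
  rewrite /c_chain (sorted_pairwise ord_gap_trans) pairwise_cat /=.
  rewrite -!(sorted_pairwise ord_gap_trans) [sorted _ lo]c_chain_filter //.
  rewrite [sorted _ hi]c_chain_filter // !andbT /=; apply/andP; split; last first.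
    by apply/allP => i /hi_gt.
  apply/allrelP => i j ilo; rewrite inE => /predU1P[->|/hi_gt]; first exact: lo_lt.
  by have := lo_lt _ ilo; lia.
have sz_a : (size a = size lo + size mid + size hi)%N.
  rewrite !size_filter -addnA -(count_predC (fun i : 'I_n => i < x)%N); congr addn.
  rewrite -(count_predUI _ (fun i : 'I_n => x + c < i)%N) -[LHS]addn0; congr addn.
    by apply: eq_count => i /=; lia.
  by rewrite (eq_count (a2 := pred0)) ?count_pred0 // => i /=; lia.
have mid_le1 : (size mid <= 1)%N.
  have : c_chain c mid by apply: c_chain_filter.
  have mid_in i : i \in mid -> (x <= i <= x + c)%N.
    by rewrite mem_filter => /andP[].
  case: (mid) mid_in => [|i [|j m]] // mid_in /= /andP[ij _].
  by have := mid_in i; have := mid_in j; rewrite !inE !eqxx orbT /=; lia.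
have := amax _ cb; rewrite chain_mnm_dvd ?c_chain_uniq //.
have -> : all (fun i => d i != 0%N) (lo ++ x :: hi).
  move: ad; rewrite chain_mnm_dvd ?c_chain_uniq // => /allP ad.
  apply/allP => i; rewrite mem_cat inE !mem_filter.
  by case/or3P => [/andP[_ /ad]|/eqP ->|/andP[_ /ad]].
move=> /(_ isT); rewrite leNgt => /negP[]; apply/deglexP.
rewrite !mdeg_chain_mnm size_cat /= sz_a.
have [|lt_mid] := leqP 1 (size mid); last by left; lia.
move=> ge_mid; right; split; first by lia.
have x_na : x \notin a by apply/negP => /xa /=; lia.
exists x; split=> [i ix|]; rewrite !chain_mnmE; last first.
  by rewrite count_cat /= eqxx (count_memPn x_na); lia.
have xi : (x == i) = false by apply/negbTE; rewrite neq_ltn ix orbT.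
rewrite count_cat /= xi add0n -[LHS]addn0; congr addn; rewrite count_filter.
  by apply: eq_count => k /=; case: eqP => // ->; rewrite ix.
rewrite (eq_count (a2 := pred0)) ?count_pred0 // => k /=.
by case: eqP => // ->; lia.
Qed.

Lemma sum_chain_mnm (P : pred nat) a :
  (\sum_(x < n | P x) chain_mnm a x)%N = count P (map val a).
Proof.
elim: a => [|i a IH]; first by rewrite big1 // => x _; rewrite chain_mnmE.
rewrite (eq_bigr (fun x => (i == x) + chain_mnm a x)%N) => [|x _]; last first.
  by rewrite !chain_mnmE.
rewrite big_split /= IH; congr addn.
rewrite big_mkcond (bigD1 i) //= eqxx big1 ?addn0 => [|x /negbTE]; first by case: ifP.
by rewrite eq_sym => ->; case: ifP.
Qed.

(** Windows that suit the monomial without its first chain [a] are rearranged along [a]: they keep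
    what they covered in the support of [d] and now contain at least min (T, size a) elements of
    [a]. Thus the uncovered degree grows by at most size a - T, the contribution of [a] to
    [gamma]. *)
Lemma decomposition_windows T d l : c_decomposition c d l ->
  exists2 bs, size bs = T &
    (\sum_(x < n | ~~ in_windows c bs x) d x <= gamma T.+1 l)%N.
Proof.
rewrite /gamma; elim=> {d l} [|d a l d_neq0 amax _ [bs sz_bs IH]].
  exists (nseq T 0%N); rewrite ?size_nseq // big_nil big1 // => x _.
  by rewrite mnm0E.
have [ca ad _] := amax.
pose S x := [exists i : 'I_n, (val i == x) && (d i != 0%N)].
have cov x : S x -> in_windows c (rev (map val a)) x.
  move=> /existsP[i /andP[/eqP <- di]]; rewrite /in_windows has_rev.
  exact: max_chain_windows amax di.
have sr : sorted (fun i j => j + c < i)%N (rev (map val a)).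
  by rewrite rev_sorted sorted_map.
have [bs' [sz_bs' cov' cnt']] := complete_windows sr cov sz_bs.
exists bs' => //; rewrite big_cons subSS.
rewrite (eq_bigr (fun x => (d - chain_mnm a)%MM x + chain_mnm a x)%N); last first.
  by move=> x _; rewrite -mnmDE submK.
rewrite big_split /= addnC leq_add //.
  rewrite (sum_chain_mnm (predC (in_windows c bs'))).
  move: cnt'; rewrite count_rev size_rev -(size_map val a).
  by rewrite -(count_predC (in_windows c bs') (map val a)); lia.
apply: leq_trans IH; rewrite !(big_mkcond (fun x => ~~ _)) leq_sum // => x _.
have [xbs|] := boolP (in_windows c bs x); last by case: ifP.
rewrite leqn0; case: ifP => // /negP xbs'; rewrite mnmBE subn_eq0.
have [->//|dx] := eqVneq (d x) 0%N; case: xbs'; apply: cov' xbs.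
by apply/existsP; exists x; rewrite eqxx.
Qed.

End Chains.

(** * Translation by a point of the scroll *)

Section Scroll.
Variables (n c : nat).
Hypothesis c_gt0 : (0 < c)%N.
Implicit Types (u v w : 'X_{1..n}).

(* Y_(k mod c) W^(k div c), a generic point of the scroll defined by the
   2-minors; the last of the c + 1 variables is W. *)
Definition scroll_mnm (k : nat) : 'X_{1..c.+1} :=
  (U_(inord (k %% c)) + U_(ord_max) *+ (k %/ c))%MM.

Definition scroll_exp v : 'X_{1..c.+1} := (\sum_(k < n) scroll_mnm k *+ v k)%MM.

Lemma scroll_mnmD k : scroll_mnm (k + c) = (U_(ord_max) + scroll_mnm k)%MM.
Proof.
rewrite /scroll_mnm modnDr divnDr // divnn c_gt0 addn1 mulmS.
by rewrite addmA (addmC _ U_(_)%MM) addmA.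
Qed.

Lemma scroll_mnm_class k (r : 'I_c) :
  scroll_mnm k (widen_ord (leqnSn c) r) = (k %% c == r)%N.
Proof.
rewrite /scroll_mnm mnmDE mulmnE !mnm1E -!val_eqE /= inordK; last first.
  by rewrite ltnS ltnW // ltn_pmod.
by rewrite (gtn_eqF (ltn_ord r)) mul0n addn0.
Qed.

Lemma scroll_mnm_max k : scroll_mnm k ord_max = (k %/ c)%N.
Proof.
rewrite /scroll_mnm mnmDE mulmnE !mnm1E -!val_eqE /= eqxx mul1n inordK; last first.
  by rewrite ltnS ltnW // ltn_pmod.
by rewrite (ltn_eqF (ltn_pmod k c_gt0)).
Qed.

Lemma scroll_exp_class v (r : nat) : (r < c)%N ->
  scroll_exp v (inord r) = (\sum_(k < n) (k %% c == r) * v k)%N.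
Proof.
move=> ltr; rewrite /scroll_exp mnm_sumE; apply: eq_bigr => k _.
rewrite mulmnE; congr muln; rewrite -(scroll_mnm_class k (Ordinal ltr)).
by congr fun_of_multinom; apply: val_inj; rewrite /= inordK // ltnS ltnW.
Qed.

Lemma scroll_exp_max v :
  scroll_exp v ord_max = (\sum_(k < n) (k %/ c) * v k)%N.
Proof.
rewrite /scroll_exp mnm_sumE; apply: eq_bigr => k _.
by rewrite mulmnE scroll_mnm_max.
Qed.

Let sumZ (F : 'I_n -> nat) : (\sum_(k < n) F k)%N%:Z = \sum_(k < n) (F k)%:Z.
Proof. by rewrite -natz natr_sum; apply: eq_bigr => k _; rewrite natz. Qed.

(** The weight of k is the combination of the exponents of [scroll_mnm c k] with coefficient h r at
    Y_r and 1 at W, so its totals over [u] and [v] agree. *)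
Lemma scroll_exp_lin u v (h : nat -> int) :
    scroll_exp v = scroll_exp u ->
  \sum_(k < n) ((u k)%:Z - (v k)%:Z) * (h (k %% c)%N + (k %/ c)%:Z) = 0.
Proof.
move=> eq_vu.
have lin0 (g : nat -> nat) :
    (\sum_(k < n) g k * v k)%N = (\sum_(k < n) g k * u k)%N ->
    \sum_(k < n) ((u k)%:Z - (v k)%:Z) * (g k)%:Z = 0.
  move=> /(congr1 Posz); rewrite !sumZ => eq_g.
  rewrite (eq_bigr (fun k : 'I_n => (g k * u k)%N%:Z - (g k * v k)%N%:Z)).
    by rewrite sumrB eq_g subrr.
  by move=> k _; rewrite mulrBl !PoszM ![(g k)%:Z * _]mulrC.
under eq_bigr => k _ do rewrite mulrDr.
rewrite big_split /= [X in _ + X](lin0 (fun k => k %/ c)%N); last first.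
  by rewrite -!scroll_exp_max eq_vu.
rewrite addr0 (eq_bigr (fun k : 'I_n => \sum_(r < c)
    h r * (((u k)%:Z - (v k)%:Z) * (k %% c == r)%N%:Z))); last first.
  move=> k _; rewrite (bigD1 (Ordinal (ltn_pmod k c_gt0))) //= eqxx mulr1 mulrC.
  rewrite big1 ?addr0 // => r /negbTE; rewrite -val_eqE /= eq_sym => ->.
  by rewrite !mulr0.
rewrite exchange_big big1 //= => r _; rewrite -mulr_sumr.
by rewrite (lin0 (fun k => (k %% c == r)%N : nat)) ?mulr0 // -!scroll_exp_class // eq_vu.
Qed.

Lemma scroll_exp_mdeg u v : scroll_exp v = scroll_exp u -> mdeg v = mdeg u.
Proof.
move=> eq_vu.
have [//] : (mdeg v)%:Z = (mdeg u)%:Z.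
have := scroll_exp_lin (fun=> 1) eq_vu; have := scroll_exp_lin (fun=> 0) eq_vu.
rewrite !mdegE !sumZ => sum0 sum1.
apply/esym/eqP; rewrite -subr_eq0 -sumrB -[X in _ == X]subr0.
rewrite -[X in _ == X - _]sum1 -[X in _ == _ - X]sum0 -sumrB.
by apply/eqP/eq_bigr => k _; ring.
Qed.

(* The monomials supported in a window are the standard monomials of the scroll,
   hence minimal among the monomials with the same image. *)
Lemma scroll_exp_le (b : nat) u v :
    (forall k : 'I_n, u k != 0 -> b <= k <= b + c)%N ->
  scroll_exp v = scroll_exp u -> (u <= v)%O.
Proof.
move=> supp_u eq_vu; rewrite leNgt; apply/negP => /deglexP [|[_ [i [eq_lt lt_i]]]].
  by rewrite (scroll_exp_mdeg eq_vu) ltnn.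
have ui : (b <= i <= b + c)%N by apply: supp_u; lia.
(* With this [h] the weight of k is the floor of (k - i) / c. For k > i it is at least [G k], with
   equality if k <= i + c, hence wherever [u k] is nonzero; elsewhere [D k] is at most 0. So
   replacing the weight by [G] does not decrease the sum over k != i, although it changes it from 0
   to - [D i] < 0. *)
pose h r := - (i %/ c)%:Z - (r < i %% c)%N%:Z.
pose G (k : nat) := (k %% c == i %% c)%N%:Z.
pose D (k : 'I_n) := (u k)%:Z - (v k)%:Z.
have sumG : \sum_(k < n) D k * G k = 0.
  have := scroll_exp_lin (fun r => (r == i %% c)%N%:Z) eq_vu.
  have := scroll_exp_lin (fun=> 0) eq_vu.
  move=> sum0 sum1; rewrite -[RHS]subr0 -[X in _ = X - _]sum1.
  rewrite -[X in _ = _ - X]sum0 -sumrB.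
  by apply: eq_bigr => k _; rewrite /D /G; ring.
move: (scroll_exp_lin h eq_vu) sumG; rewrite (bigD1 i) //= [in X in _ -> X](bigD1 i) //=.
have -> : h (i %% c)%N + (i %/ c)%:Z = 0 by rewrite /h ltnn subr0 addNr.
rewrite mulr0 add0r; have -> : G i = 1 by rewrite /G eqxx.
rewrite mulr1.
suff: \sum_(k < n | k != i) D k * (h (k %% c)%N + (k %/ c)%:Z) <=
      \sum_(k < n | k != i) D k * G k.
  move=> + S0 DS; rewrite S0 => le0; have Di : 0 < D i by rewrite /D; lia.
  by move: DS le0; move: (\sum_(_ < _ | _) _) => S DS le0; lia.
apply: Num.Theory.ler_sum => k neq_ki; have [lt_ki|le_ik] := ltnP k i.
  by rewrite /D eq_lt // subrr !mul0r.
have lt_ik : (i < k)%N by rewrite ltn_neqAle eq_sym neq_ki.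
have [def_k def_i] := (divn_eq k c, divn_eq i c).
have [lt_rk lt_ri] := (ltn_pmod k c_gt0, ltn_pmod i c_gt0).
have le_q : (i %/ c <= k %/ c)%N by rewrite leq_div2r // ltnW.
have F_ge : G k <= h (k %% c)%N + (k %/ c)%:Z.
  move: def_k def_i lt_rk lt_ri le_q lt_ik; rewrite /G /h.
  move: (k %/ c)%N (k %% c)%N (i %/ c)%N (i %% c)%N => qk rk qi ri.
  move=> def_k def_i lt_rk lt_ri le_q lt_ik.
  have [lt_q|le_q'] := ltnP qi qk; first by lia.
  have eq_q : qk = qi by lia.
  by rewrite eq_q in def_k *; lia.
have [uk0|uk] := eqVneq (u k) 0%N.
  by rewrite /D uk0 sub0r !mulNr Num.Theory.lerN2 Num.Theory.ler_wpM2l.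
suff -> : h (k %% c)%N + (k %/ c)%:Z = G k by [].
have le_k : (k <= i + c)%N by have := supp_u k uk; lia.
move: def_k def_i lt_rk lt_ri le_q lt_ik le_k; rewrite /G /h.
move: (k %/ c)%N (k %% c)%N (i %/ c)%N (i %% c)%N => qk rk qi ri.
move=> def_k def_i lt_rk lt_ri le_q lt_ik le_k.
have [lt_q|le_q'] := ltnP qi qk; last first.
  have eq_q : qk = qi by lia.
  by rewrite eq_q in def_k *; lia.
have le_q1 : (qk <= qi.+1)%N by nia.
have eq_q : qk = qi.+1 by lia.
by rewrite eq_q mulSn in def_k *; lia.
Qed.

Definition window_part (b : nat) u : 'X_{1..n} :=
  [multinom if (b <= k <= b + c)%N then u k else 0%N | k < n].

Lemma window_part_le b u : (window_part b u <= u)%MM.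
Proof. by apply/mnm_lepP => k; rewrite mnmE; case: ifP. Qed.

Lemma window_part_scroll_le b u v :
  scroll_exp v = scroll_exp (window_part b u) -> (window_part b u <= v)%O.
Proof. by apply: (scroll_exp_le (b := b)) => k; rewrite mnmE; case: ifP. Qed.

Section Translation.
Variable K : comNzRingType.

(* f |-> f (x + z), where z is the generic point of the scroll. *)
Definition scroll_translate : {mpoly K[n]} -> {mpoly {mpoly K[n]}[c.+1]} :=
  mmap (@mpolyC c.+1 {mpoly K[n]} \o @mpolyC n K)
    (fun k : 'I_n => ('X_k)%:MP + 'X_[scroll_mnm k]).

HB.instance Definition _ := GRing.RMorphism.on scroll_translate.

Lemma scroll_translateU (k : 'I_n) :
  scroll_translate 'X_k = ('X_k)%:MP + 'X_[scroll_mnm k].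
Proof. by rewrite /scroll_translate mmapX mmap1U. Qed.

(** A summation range independent of [m] is needed to distribute a product of such expansions over
    functions into ['I_N]; the extra terms have binomial coefficient 0. *)
Lemma exprDn_wide (A : comNzRingType) (x y : A) m N : (m < N)%N ->
  (x + y) ^+ m = \sum_(i < N) x ^+ (m - i) * y ^+ i *+ 'C(m, i).
Proof.
move=> lt_mN; rewrite exprDn.
rewrite (big_ord_widen N (fun i => x ^+ (m - i) * y ^+ i *+ 'C(m, i))) //.
rewrite big_mkcond; apply: eq_bigr => i _; case: ltnP => // lt_mi.
by rewrite bin_small // mulr0n.
Qed.

Lemma scroll_translateX v N : (mdeg v < N)%N ->
  scroll_translate 'X_[v] = \sum_(j : {ffun 'I_n -> 'I_N})
    ('X_[v - [multinom j k | k < n]])%:MP * 'X_[scroll_exp [multinom j k | k < n]]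
      *+ \prod_(k < n) 'C(v k, j k).
Proof.
move=> lt_vN; rewrite /scroll_translate mmapX /mmap1.
rewrite (eq_bigr (fun k => \sum_(i < N) ('X_k)%:MP ^+ (v k - i) *
    'X_[scroll_mnm k] ^+ i *+ 'C(v k, i))) => [|k _]; last first.
  rewrite (exprDn_wide _ _ (N := N)) // (leq_ltn_trans _ lt_vN) //.
  by rewrite mdegE (bigD1 k) //= leq_addr.
rewrite bigA_distr_bigA; apply: eq_bigr => j _.
rewrite prodrMn; congr (_ *+ _); rewrite big_split /=; congr (_ * _).
  rewrite mpolyXE_id rmorph_prod; apply: eq_bigr => k _.
  by rewrite rmorphXn /= mnmBE mnmE.
rewrite /scroll_exp -mprodXE; apply: eq_bigr => k _.
by rewrite mpolyXn mnmE.
Qed.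

Lemma mcoeff_scroll_translateX v N mu w : (mdeg v < N)%N ->
  (scroll_translate 'X_[v])@_mu@_w = \sum_(j : {ffun 'I_n -> 'I_N}
      | (scroll_exp [multinom j k | k < n] == mu) && (v - [multinom j k | k < n] == w)%MM)
    (\prod_(k < n) 'C(v k, j k))%:R.
Proof.
move=> lt_vN; rewrite (scroll_translateX lt_vN) !raddf_sum [RHS]big_mkcond.
apply: eq_bigr => j _; rewrite !raddfMn /= mcoeffCM mcoeffX.
case: eqP => [_|_] /=.
  by rewrite mulr1 mcoeffX; case: eqP => // _; rewrite mul0rn.
by rewrite mulr0 mcoeff0 mul0rn.
Qed.

Let binom_le v N (j : {ffun 'I_n -> 'I_N}) :
  (\prod_(k < n) 'C(v k, j k) != 0)%N -> ([multinom j k : nat | k < n] <= v)%MM.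
Proof.
move=> nz; apply/mnm_lepP => k; rewrite mnmE leqNgt; apply: contraNN nz => lt_vj.
by rewrite (bigD1 k) //= bin_small.
Qed.

Lemma scroll_translate_supp v mu w : (scroll_translate 'X_[v])@_mu@_w != 0 ->
  exists2 j, v = (w + j)%MM & scroll_exp j = mu.
Proof.
rewrite (mcoeff_scroll_translateX _ _ (ltnSn _)).
have [/existsP[j /and3P[/eqP exp_j /eqP <- nz]] _|/existsPn no_j] :=
    boolP [exists j : {ffun 'I_n -> 'I_(mdeg v).+1},
      [&& (scroll_exp [multinom j k : nat | k < n] == mu),
        (v - [multinom j k : nat | k < n] == w)%MM
      & (\prod_(k < n) 'C(v k, j k) != 0)%N]].
  by exists [multinom j k : nat | k < n]; rewrite ?submK ?binom_le.
rewrite big1 ?eqxx // => j /andP[exp_j vj].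
by have := no_j j; rewrite exp_j vj /= negbK => /eqP ->.
Qed.

(** Only one term of the expansion contributes, since the part that is split off is determined by
    its complement in [u]. Its binomial coefficients are all C(m, m) or C(m, 0), so the result is 1
    in every characteristic. *)
Lemma scroll_translate_window b u :
  (scroll_translate 'X_[u])@_(scroll_exp (window_part b u))@_(u - window_part b u)
    = 1.
Proof.
have up_lt k : (window_part b u k < (mdeg u).+1)%N.
  rewrite ltnS (leq_trans (mnm_lepP (window_part_le b u) k)) //.
  by rewrite mdegE (bigD1 k) //= leq_addr.
pose j0 := [ffun k => Ordinal (up_lt k)].
have j0E : [multinom j0 k : nat | k < n] = window_part b u.
  by apply/mnmP => k; rewrite mnmE ffunE.
rewrite (mcoeff_scroll_translateX _ _ (ltnSn _)) (bigD1 j0) /= ?j0E ?eqxx //.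
rewrite [in X in X + _]big1 => [|k _]; last first.
  by rewrite ffunE /= mnmE; case: ifP; rewrite ?binn ?bin0.
rewrite big1 ?addr0 // => j /andP[/andP[_ /eqP uj] neq_j].
apply/eqP; apply: contraNT neq_j => nz; apply/eqP/ffunP => k; apply: val_inj.
have nz' : (\prod_(k < n) 'C(u k, j k) != 0)%N.
  by apply: contraNneq nz => ->.
have le_ju := binom_le nz'.
have := congr1 (fun m : 'X_{1..n} => m k) uj.
rewrite /= ffunE /= !mnmBE mnmE.
have := mnm_lepP le_ju k; have := mnm_lepP (window_part_le b u) k.
by rewrite mnmE; lia.
Qed.

(** If a monomial v of [f] contributes to the coefficient at w, then v = w + j, where j has the same
    image as the window part of [u] and so is at least that part. For w at least [u - up] this gives
    v >= u, which forces v = u and w = [u - up]: nothing cancels there and nothing larger occurs. *)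
Lemma scroll_translate_lead b (f : {mpoly K[n]}) :
    let g := (scroll_translate f)@_(scroll_exp (window_part b (mlead f))) in
  f != 0 -> g != 0 /\ mlead g = (mlead f - window_part b (mlead f))%MM.
Proof.
set u := mlead f; set up := window_part b u => g f0.
have gE w : g@_w = \sum_(v <- msupp f)
    f@_v * (scroll_translate 'X_[v])@_(scroll_exp up)@_w.
  rewrite /g {1}(mpolyE f) (raddf_sum scroll_translate) !(raddf_sum (mcoeff _)).
  apply: eq_bigr => v _.
  by rewrite /= /scroll_translate mmapZ !mcoeffCM.
have term0 v w : v \in msupp f -> ((u - up)%MM <= w)%O -> (v != u) || (w != u - up)%MM ->
    (scroll_translate 'X_[v])@_(scroll_exp up)@_w = 0.
  move=> /msupp_le_mlead le_vu le_w; apply: contraTeq => /scroll_translate_supp[j vE].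
  move=> /window_part_scroll_le le_j; rewrite negb_or !negbK.
  have le_uv : (u <= v)%O by rewrite vE -(submK (window_part_le b u)) lem_add.
  have eq_vu : v = u by apply: le_anti; rewrite le_vu le_uv.
  rewrite eq_vu eqxx /= eq_le le_w andbT leNgt; apply/negP => lt_w.
  suff : (u < v)%O by rewrite eq_vu ltxx.
  by rewrite vE -(submK (window_part_le b u)) ltmc_le_add.
have gu : g@_(u - up) = f@_u.
  have u_f : u \in msupp f by exact: mlead_supp.
  rewrite gE (bigD1_seq u u_f (msupp_uniq f)).
  transitivity (f@_u * 1 + 0); last by rewrite mulr1 addr0.
  congr (f@_u * _ + _); first exact: scroll_translate_window.
  by rewrite big_seq_cond big1 // => v /andP[v_f neq_vu]; rewrite term0 ?neq_vu ?mulr0.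
have g_up : (u - up)%MM \in msupp g by rewrite mcoeff_msupp gu mleadc_eq0.
have g0 : g != 0 by apply: contraTneq g_up => ->; rewrite msupp0.
split=> //; apply: le_anti; rewrite msupp_le_mlead // andbT leNgt.
apply/negP => lt_g; move: (mlead_supp g0); rewrite mcoeff_msupp gE big_seq big1 ?eqxx //.
by move=> v v_f; rewrite term0 ?mulr0 // ?(ltW lt_g) // (gt_eqF lt_g) orbT.
Qed.

End Translation.
End Scroll.

(** * Generic points of secant varieties *)

(* [gp_eval f] is f (p + eps q), with p a generic point of the T-th secant
   variety of the scroll, i.e. a sum of T generic points [gp_z l] of the scroll,
   and q a generic point of the affine space. Reduction modulo eps gives f (p),
   and [gp_lead] bounds the eps-adic order of f (p + eps q). *)
Record generic_point (K : fieldType) (n c T : nat) := GenericPoint {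
  gp_ring : idomainType;
  gp_residue : idomainType;
  gp_eps : gp_ring;
  gp_eval : {rmorphism {mpoly K[n]} -> gp_ring};
  gp_red : {rmorphism gp_ring -> gp_residue};
  gp_w : nat -> gp_residue;
  gp_z : nat -> nat -> gp_residue;
  gp_eps_neq0 : gp_eps != 0;
  gp_redP : forall x, gp_red x = 0 <-> exists y, x = gp_eps * y;
  gp_zD : forall l j, gp_z l (j + c) = gp_w l * gp_z l j;
  gp_evalX : forall k : 'I_n, gp_red (gp_eval 'X_k) = \sum_(l < T) gp_z l k;
  gp_lead : forall f bs s y, f != 0 -> size bs = T ->
    gp_eval f = gp_eps ^+ s * y ->
    (s <= \sum_(x < n | ~~ in_windows c bs x) mlead f x)%N
}.

Section GenericPointBase.
Variables (K : fieldType) (n c : nat).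

(** This is f (eps q) with eps the polynomial variable: for T = 0 the point p is the origin. *)
Definition scale_eval : {mpoly K[n]} -> {poly {mpoly K[n]}} :=
  mmap (polyC \o @mpolyC n K) (fun k : 'I_n => 'X_k *: 'X).

HB.instance Definition _ := GRing.RMorphism.on scale_eval.

Lemma scale_evalX m : scale_eval 'X_[m] = 'X_[m] *: 'X^(mdeg m).
Proof.
rewrite /scale_eval mmapX /mmap1.
rewrite (eq_bigr (fun k => 'X_k ^+ m k *: 'X^(m k))) => [|k _]; last exact: exprZn.
by rewrite scaler_prod -mpolyXE_id prodrXr mdegE.
Qed.

Lemma scale_eval_lead f : (scale_eval f)`_(mdeg (mlead f))@_(mlead f) = mleadc f.
Proof.
rewrite [X in scale_eval X](mpolyE f) (raddf_sum scale_eval) coef_sum.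
rewrite (raddf_sum (mcoeff _)).
have term m : ((scale_eval (f@_m *: 'X_[m]))`_(mdeg (mlead f)))@_(mlead f)
    = f@_m * (m == mlead f)%:R.
  rewrite -mul_mpolyC rmorphM /= scale_evalX /scale_eval mmapC /= mul_polyC.
  rewrite !coefZ coefXn mcoeffCM; congr (_ * _).
  case: eqP => [eq_m|neq_m]; first by rewrite mulr1 mcoeffX.
  by rewrite mulr0 mcoeff0; case: eqP neq_m => // ->.
rewrite (eq_bigr _ (fun m _ => term m)).
have [->|f0] := eqVneq f 0; first by rewrite msupp0 big_nil mcoeff0.
rewrite (bigD1_seq (mlead f) (mlead_supp f0) (msupp_uniq f)) /= eqxx mulr1.
by rewrite big1 ?addr0 // => m /negbTE ->; rewrite mulr0.
Qed.

Lemma generic_point0 : generic_point K n c 0.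
Proof.
apply: (@GenericPoint K n c 0 {poly {mpoly K[n]}} {mpoly K[n]} 'X scale_eval
  (horner_eval 0) (fun=> 0) (fun _ _ => 0)).
- by rewrite polyX_eq0.
- move=> x; rewrite /= /horner_eval; split=> [x0|[y ->]]; last first.
    by rewrite hornerM hornerX mul0r.
  have /factor_theorem[y ->] : root x 0 by apply/rootP.
  by exists y; rewrite subr0 mulrC.
- by move=> l j; rewrite mulr0.
- move=> k; rewrite big_ord0 /= /horner_eval scale_evalX.
  by rewrite mdeg1 hornerZ hornerX mulr0.
(* Without windows the bound is the degree of the leading monomial, and the coefficient of that
   power of eps is nonzero. *)
move=> f bs s y f0 /size0nil -> /= eval_f.
rewrite (eq_bigl xpredT) // -mdegE leqNgt; apply/negP => lt_s.
have := scale_eval_lead f; rewrite eval_f coefXnM lt_s mcoeff0 => /esym/eqP.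
by rewrite mleadc_eq0 (negbTE f0).
Qed.
End GenericPointBase.

Section GenericPointStep.
Variables (K : fieldType) (n c T : nat) (p : generic_point K n c T).
Hypothesis c_gt0 : (0 < c)%N.

(** A further generic point of the scroll, in c + 1 fresh variables, is added to p + eps q. *)
Definition secant_eval : {mpoly K[n]} -> {mpoly (gp_ring p)[c.+1]} :=
  map_mpoly (gp_eval p) \o @scroll_translate n c K.

HB.instance Definition _ := GRing.RMorphism.on secant_eval.

Lemma secant_evalU (k : 'I_n) :
  secant_eval 'X_k = (gp_eval p 'X_k)%:MP + 'X_[scroll_mnm c k].
Proof.
rewrite /secant_eval /= scroll_translateU rmorphD /=.
by rewrite map_mpolyX [X in X + _]map_mpolyC.
Qed.

Lemma mpoly_dvdCP (A : idomainType) (k : nat) (e : A) (x : {mpoly A[k]}) :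
  (forall m, exists y, x@_m = e * y) -> exists y, x = e%:MP * y.
Proof.
move=> dvd_x; rewrite [x]mpolyE.
elim: (msupp x) => [|m r [y IH]]; first by exists 0; rewrite big_nil mulr0.
have [z xm] := dvd_x m; exists (z *: 'X_[m] + y).
by rewrite big_cons IH xm mulrDr !mul_mpolyC scalerA.
Qed.

(** For [gp_lead], the first window is used up by taking the coefficient at the image of the
    corresponding part of the leading monomial. As eps is constant in the fresh variables, its power
    still divides this coefficient, and the remaining windows are handled by [p]. *)
Lemma generic_pointS : generic_point K n c T.+1.
Proof.
pose w l : {mpoly (gp_residue p)[c.+1]} :=
  if l is l'.+1 then (gp_w p l')%:MP else 'X_ord_max.
pose z l j : {mpoly (gp_residue p)[c.+1]} :=
  if l is l'.+1 then (gp_z p l' j)%:MP else 'X_[scroll_mnm c j].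
apply: (@GenericPoint K n c T.+1 {mpoly (gp_ring p)[c.+1]}
  {mpoly (gp_residue p)[c.+1]} (gp_eps p)%:MP secant_eval
  (map_mpoly (gp_red p)) w z).
- by rewrite mpolyC_eq0 gp_eps_neq0.
- move=> x; split=> [red_x|[y ->]].
    apply: mpoly_dvdCP => m; apply/gp_redP.
    by rewrite -mcoeff_map_mpoly red_x mcoeff0.
  have red_eps : gp_red p (gp_eps p) = 0 by apply/gp_redP; exists 1; rewrite mulr1.
  suff eps0 : map_mpoly (gp_red p) (gp_eps p)%:MP_[c.+1] = 0.
    by rewrite rmorphM [X in X * _]eps0 mul0r.
  by rewrite map_mpolyC [X in X%:MP]red_eps mpolyC0.
- move=> [|l] j; last by rewrite /= gp_zD mpolyCM.
  by rewrite /= scroll_mnmD // mpolyXD.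
- move=> k; transitivity (map_mpoly (gp_red p)
      ((gp_eval p 'X_k)%:MP + 'X_[scroll_mnm c k] : {mpoly _[c.+1]})).
    by congr map_mpoly; exact: secant_evalU.
  rewrite big_ord_recl rmorphD /= map_mpolyX addrC.
  by rewrite [X in _ + X]map_mpolyC [X in X%:MP]gp_evalX (raddf_sum (@mpolyC _ _)).
move=> f [//|b bs] s y f0 [sz_bs] eval_f.
pose mu := scroll_exp c (window_part c b (mlead f)).
have [g0 lead_g] := scroll_translate_lead c_gt0 b f0.
have := @gp_lead _ _ _ _ p _ bs s y@_mu g0 sz_bs.
rewrite -mcoeff_map_mpoly [map_mpoly _ _]eval_f -rmorphXn /= mcoeffCM.
move=> /(_ erefl) /leq_trans -> //; rewrite lead_g.
rewrite big_mkcond [X in (_ <= X)%N]big_mkcond leq_sum // => x _.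
rewrite /= mnmBE mnmE; case: (b <= x <= b + c)%N; case: in_windows;
  by rewrite /= ?subnn ?subn0.
Qed.
End GenericPointStep.

Lemma secant_generic_point K n c T : (0 < c)%N -> generic_point K n c T.
Proof.
move=> c_gt0; elim: T => [|T p]; first exact: generic_point0.
exact: generic_pointS p c_gt0.
Qed.

(** * Powers and symbolic powers *)

Section IdealTheory.
Variable A : comNzRingType.
Implicit Types (I J S : A -> Prop) (f g : A).

Lemma ideal_sum J k (F : 'I_k -> A) :
  is_ideal J -> (forall i, J (F i)) -> J (\sum_(i < k) F i).
Proof. by case=> J0 JD _ JF; elim/big_ind: _ => // i _; exact: JF. Qed.

Lemma ideal_gen_ideal S : is_ideal (ideal_gen S).
Proof.
split.
- by exists 0%N, (fun=> 0), (fun=> 0); split=> [[]|] //; rewrite big_ord0.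
- move=> _ _ [k1 [r1 [g1 [S1 ->]]]] [k2 [r2 [g2 [S2 ->]]]].
  exists (k1 + k2)%N, (fun i => match split i with inl j => r1 j | inr j => r2 j end).
  exists (fun i => match split i with inl j => g1 j | inr j => g2 j end).
  split=> [i|]; first by case: split.
  rewrite big_split_ord; congr (_ + _); apply: eq_bigr => i _.
    by rewrite (unsplitK (inl i)).
  by rewrite (unsplitK (inr i)).
move=> a _ [k [r [g [Sg ->]]]]; exists k, (fun i => a * r i), g; split=> //.
by rewrite mulr_sumr; apply: eq_bigr => i _; rewrite mulrA.
Qed.

Lemma ideal_gen_sub S f : S f -> ideal_gen S f.
Proof.
by move=> Sf; exists 1%N, (fun=> 1), (fun=> f); split=> //; rewrite big_ord1 mul1r.
Qed.

Lemma ideal_gen_min S J : is_ideal J -> (forall f, S f -> J f) ->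
  forall f, ideal_gen S f -> J f.
Proof.
move=> idJ SJ f [k [r [g [Sg ->]]]]; apply: ideal_sum => // i.
by case: idJ => _ _; apply; apply: SJ.
Qed.

Lemma ideal_pow_ideal I s : is_ideal (ideal_pow I s).
Proof. exact: ideal_gen_ideal. Qed.

Lemma ideal_pow0 I f : ideal_pow I 0 f.
Proof.
have [_ _ absorb] := ideal_pow_ideal I 0; rewrite -[f]mulr1; apply: absorb.
by apply: ideal_gen_sub; exists (fun=> 0) => [[]|] //; rewrite big_ord0.
Qed.

Lemma ideal_powM I a b f g :
  ideal_pow I a f -> ideal_pow I b g -> ideal_pow I (a + b) (f * g).
Proof.
have [pow0 powD powM] := ideal_pow_ideal I (a + b).
(* This colon ideal lets [ideal_gen_min] reduce first one factor, then the other, to a product of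
   elements of [I]. *)
have idl x : is_ideal (fun y => ideal_pow I (a + b) (y * x)).
  by split=> [|y z|r y]; rewrite ?mul0r ?mulrDl -?mulrA; [ | exact: powD | exact: powM].
move=> If Ig; move: f If; apply: ideal_gen_min => // _ [F IF ->].
rewrite mulrC; move: g Ig; apply: ideal_gen_min => // _ [G IG ->].
rewrite mulrC; apply: ideal_gen_sub.
exists (fun i => match split i with inl j => F j | inr j => G j end).
  by move=> i; case: split.
rewrite big_split_ord; congr (_ * _); apply: eq_bigr => i _.
  by rewrite (unsplitK (inl i)).
by rewrite (unsplitK (inr i)).
Qed.

Lemma ideal_pow_leq I a b f : (a <= b)%N -> ideal_pow I b f -> ideal_pow I a f.
Proof.
move=> /subnKC <-; move: f; apply: ideal_gen_min; first exact: ideal_pow_ideal.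
move=> _ [F IF ->]; rewrite big_split_ord [X in ideal_pow _ _ X]mulrC.
have [_ _ absorb] := ideal_pow_ideal I a; apply: absorb.
by apply: ideal_gen_sub; exists (fun i => F (lshift _ i)).
Qed.

Lemma det_ideal_pow I k (M : 'M[A]_k) :
  (forall i j, I (M i j)) -> ideal_pow I k (\det M).
Proof.
move=> IM; have [pow0 powD absorb] := ideal_pow_ideal I k.
rewrite /determinant; elim/big_ind: _ => // s _; apply: absorb.
by apply: ideal_gen_sub; exists (fun i => M i (s i)).
Qed.

End IdealTheory.

Section SymbolicPowerTheory.
Variables (A : idomainType) (I : A -> Prop).
Hypothesis I_ideal : is_ideal I.
Hypothesis I_prime : forall a b, ~ I a -> ~ I b -> ~ I (a * b).
Hypothesis I_proper : ~ I 1.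

Let notI_neq0 h : ~ I h -> tofrac h != 0.
Proof.
case: I_ideal => I0 _ _; apply: contra_not_neq => /eqP.
by rewrite tofrac_eq0 => /eqP ->.
Qed.

(** The product of the finitely many denominators can be cleared at once, and it stays outside [I]
    because [I] is prime. *)
Lemma symbolic_powerP s f :
  symbolic_power I s f <-> exists2 h, ~ I h & ideal_pow I s (h * f).
Proof.
split=> [|[h Ih powhf]]; last first.
  exists 1%N, (fun=> tofrac 1 / tofrac h), (fun=> h * f); split=> // [_|].
    by exists 1, h.
  by rewrite big_ord1 tofracM tofrac1 mul1r mulKf // notI_neq0.
case=> k [r [g [loc_r pow_g f_eq]]].
suff [h Ih [x powx hx]] : exists2 h, ~ I h & exists2 x, ideal_pow I s x
    & tofrac h * tofrac f = tofrac x.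
  by exists h => //; suff -> : h * f = x by []; apply/eqP; rewrite -tofrac_eq tofracM hx.
rewrite {}f_eq; elim: k r g loc_r pow_g => [|k IH] r g loc_r pow_g.
  exists 1 => //; exists 0; first by case: (ideal_pow_ideal I s).
  by rewrite big_ord0 mulr0 tofrac0.
have [h Ih [x powx hx]] := IH (r \o lift ord0) (g \o lift ord0)
  (fun i => loc_r _) (fun i => pow_g _).
have [a [b [Ib r0]]] := loc_r ord0.
have [_ powD powM] := ideal_pow_ideal I s.
exists (b * h); first exact: I_prime.
exists (h * a * g ord0 + b * x); first by apply: powD; apply: powM.
rewrite big_ord_recl mulrDr r0 !tofracD !tofracM -hx.
have b0 := notI_neq0 Ib; congr (_ + _); last by rewrite -mulrA.
by field.
Qed.

Lemma symbolic_power_ideal s : is_ideal (symbolic_power I s).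
Proof.
have [pow0 powD powM] := ideal_pow_ideal I s; split=> [|f g|r f].
- by apply/symbolic_powerP; exists 1; rewrite ?mulr0.
- move=> /symbolic_powerP[h Ih hf] /symbolic_powerP[h' Ih' hg].
  apply/symbolic_powerP; exists (h * h'); first exact: I_prime.
  rewrite mulrDr; apply: powD; first by rewrite mulrAC mulrC; apply: powM.
  by rewrite -mulrA; apply: powM.
move=> /symbolic_powerP[h Ih hf]; apply/symbolic_powerP; exists h => //.
by rewrite mulrCA; apply: powM.
Qed.

End SymbolicPowerTheory.

(** * The c-decomposition *)

Section Decompositions.
Variables (n c : nat).
Implicit Types (a b : seq 'I_n) (d : 'X_{1..n}) (l : seq (seq 'I_n)).

Lemma c_chain_size a : c_chain c a -> (size a <= n)%N.
Proof.
by move=> /c_chain_uniq/card_uniqP <-; rewrite -[n in (_ <= n)%N]card_ord max_card.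
Qed.

Lemma chain_mnm_inj a b :
  c_chain c a -> c_chain c b -> chain_mnm a = chain_mnm b -> a = b.
Proof.
move=> ca cb eq_ab; apply: (irr_sorted_eq (@ord_gap_trans n c)) => // [i|i]; first lia.
have := congr1 (fun m : 'X_{1..n} => (m i != 0)%N) eq_ab.
by rewrite /= !chain_mnmE -!lt0n -!has_count !has_pred1.
Qed.

Lemma max_chain_exists d : d != 0%MM -> exists a, max_chain c d a.
Proof.
move=> d0; have [x dx] : exists x, d x != 0%N.
  apply/existsP; apply: contraNT d0 => /existsPn d0; apply/eqP/mnmP => i.
  by rewrite mnm0E; apply/eqP; rewrite -[_ == _]negbK.
have sz a : c_chain c a -> (size a <= n)%N by exact: c_chain_size.
(* Chains have at most [n] elements, so the maximum can be taken over a finite type. *)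
pose P (a : n.-bseq 'I_n) := c_chain c a && (chain_mnm a <= d)%MM.
have x1 : (size [:: x] <= n)%N by exact: sz.
have Px : P (Bseq x1).
  by rewrite /P /= chain_mnm_dvd //= dx.
case: (arg_maxP (fun a : n.-bseq 'I_n => chain_mnm a) Px).
move=> a /andP[ca ad] amax; exists a; split=> // b cb bd.
by apply: (amax (Bseq (sz _ cb))); rewrite /P cb.
Qed.

Lemma max_chain_unique d a b : max_chain c d a -> max_chain c d b -> a = b.
Proof.
move=> [ca ad amax] [cb bd bmax]; apply: chain_mnm_inj => //.
by apply: le_anti; rewrite amax ?bmax.
Qed.

Lemma max_chain_nonempty d a : d != 0%MM -> max_chain c d a -> a != [::].
Proof.
move=> d0 amax; apply: contraNneq d0 => a0; apply/eqP/mnmP => x; rewrite mnm0E.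
by apply/eqP; apply: contraT => /(max_chain_windows amax); rewrite a0.
Qed.

Lemma c_decomposition_exists d : exists l, c_decomposition c d l.
Proof.
elim: {d}_.+1 {-2}d (ltnSn (mdeg d)) => // k IH d le_dk.
have [->|d0] := eqVneq d 0%MM; first by exists [::]; constructor.
have [a amax] := max_chain_exists d0.
have [_ ad _] := amax; have a0 := max_chain_nonempty d0 amax.
have [|l dl] := IH (d - chain_mnm a)%MM; last by exists (a :: l); constructor.
have := congr1 mdeg (submK ad); rewrite mdegD mdeg_chain_mnm.
by case: (a) a0 => //= i a' _; lia.
Qed.

Lemma c_decomposition_inv d l : c_decomposition c d l ->
  if l is a :: l' then
    [/\ d != 0%MM, max_chain c d a & c_decomposition c (d - chain_mnm a)%MM l']
  else d = 0%MM.
Proof. by case. Qed.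

Lemma c_decomposition_unique d l1 l2 :
  c_decomposition c d l1 -> c_decomposition c d l2 -> l1 = l2.
Proof.
elim: l1 l2 d => [|a l1 IH] [|b l2] d // /c_decomposition_inv dl1
  /c_decomposition_inv dl2.
- by case: dl2; rewrite dl1 eqxx.
- by case: dl1; rewrite dl2 eqxx.
case: dl1 dl2 => _ amax dl1 [_ bmax dl2].
have eq_ab := max_chain_unique amax bmax.
by rewrite -eq_ab in dl2 *; rewrite (IH _ _ dl1 dl2).
Qed.

Lemma c_decomposition_mnm d l :
  c_decomposition c d l -> d = (\sum_(a <- l) chain_mnm a)%MM.
Proof.
elim=> {d l} [|d a l _ [_ ad _] _ IH]; first by rewrite big_nil.
by rewrite big_cons -IH addmC submK.
Qed.

Lemma c_decomposition_chain d l :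
  c_decomposition c d l -> forall a, a \in l -> c_chain c a /\ (chain_mnm a <= d)%MM.
Proof.
elim=> {d l} [|d a l _ [ca ad _] _ IH] b //.
rewrite inE => /predU1P[->|/IH[cb bd]]; split=> //.
exact: lepm_trans bd (lem_subr _ _).
Qed.

(* Dropping the chains of size <= T and shortening the last of the remaining
   ones turns a c-decomposition into another one. *)
Lemma trim_decomposition T s d l :
    c_decomposition c d l -> (s <= gamma T.+1 l)%N ->
  exists d' l', [/\ c_decomposition c d' l', (d' <= d)%MM,
    all (fun a => T < size a)%N l' & gamma T.+1 l' = s].
Proof.
rewrite /gamma => dl; elim: dl s => {d l} [|d a l d0 amax dl IH] s.
  rewrite big_nil leqn0 => /eqP ->.
  exists 0%MM, [::]; split; rewrite ?big_nil ?lepm_refl //.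
  exact: c_decomposition_nil.
have [ca ad a_max] := amax; rewrite big_cons subSS => le_s.
have [->|s_gt0] := posnP s.
  exists 0%MM, [::]; split; rewrite ?big_nil //; last first.
    by apply/mnm_lepP => i; rewrite mnm0E.
  exact: c_decomposition_nil.
have [le_sa|lt_as] := leqP s (size a - T).
  pose b := take (T + s) a.
  have sz_b : size b = (T + s)%N by rewrite size_take_min; lia.
  have cb : c_chain c b by apply: take_sorted.
  have ba : (chain_mnm b <= chain_mnm a)%MM.
    apply/mnm_lepP => i; rewrite !chain_mnmE.
    rewrite -[a in X in (_ <= X)%N](cat_take_drop (T + s)).
    by rewrite count_cat leq_addr.
  exists (chain_mnm b), [:: b]; split=> /=.
  - constructor.
    + by rewrite -mdeg_eq0 mdeg_chain_mnm sz_b; lia.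
    + by split=> [||e _ /lem_leo]; rewrite ?lepm_refl.
    + suff -> : (chain_mnm b - chain_mnm b)%MM = 0%MM by exact: c_decomposition_nil.
      by apply/mnmP => i; rewrite mnmBE mnm0E subnn.
  - exact: lepm_trans ba ad.
  - by rewrite sz_b; lia.
  - by rewrite big_seq1 sz_b; lia.
(* Later chains are no longer than [a]; if [a] contributed nothing to [gamma], neither would they,
   against s > 0. *)
have lt_Ta : (T < size a)%N.
  rewrite ltnNge; apply/negP => le_aT.
  suff : (\sum_(b <- l) ((size b).+1 - T.+1))%N = 0%N by lia.
  rewrite big_seq big1 // => b /(c_decomposition_chain dl)[cb bd].
  have := a_max b cb (lepm_trans bd (lem_subr _ _)).
  by move=> /lemc_mdeg; rewrite !mdeg_chain_mnm; lia.
have [|d' [l' [dl' d'd all_l' gam_l']]] := IH (s - (size a - T))%N; first by lia.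
exists (d' + chain_mnm a)%MM, (a :: l').
have le_d : (d' + chain_mnm a <= d)%MM.
  apply/mnm_lepP => i; rewrite mnmDE.
  by have := mnm_lepP d'd i; have := mnm_lepP ad i; rewrite mnmBE; lia.
split=> //=; last by rewrite big_cons gam_l' subSS; lia.
  constructor; last by rewrite addmK.
    by rewrite -mdeg_eq0 mdegD mdeg_chain_mnm; lia.
  split=> // [|b cb bd]; first exact: lem_addl.
  by apply: a_max => //; apply: lepm_trans bd le_d.
by rewrite lt_Ta.
Qed.

End Decompositions.

(** * Minors *)

Section HankelMinors.
Variables (K : fieldType) (n c : nat).
Hypothesis c_gt0 : (0 < c)%N.

(** An arbitrary index function also covers submatrices and bordered minors, whose rows need not be
    consecutive. *)
Definition var_mx s (kappa : 'I_s -> 'I_s -> 'I_n) : 'M[{mpoly K[n]}]_s :=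
  \matrix_(i, j) 'X_(kappa i j).

(** Let i0 be the first row moved by [sigma]. In the rows and columns from i0 on, the entry at (i0,
    i0) has the smallest index and, as [f] is strictly increasing and c > 0, no other entry there
    has this index. So the two products agree in all variables of smaller index, and only the
    diagonal one uses that entry. *)
Lemma diagonal_lt s (f : 'I_s -> nat) (kappa : 'I_s -> 'I_s -> 'I_n) (sigma : 'S_s) :
    {homo f : i j / (i < j)%N} -> (forall i j, kappa i j = f j + i * c :> nat)%N ->
    sigma != 1%g ->
  ((\sum_i U_(kappa i (sigma i)))%MM < (\sum_i U_(kappa i i))%MM)%O.
Proof.
move=> f_homo kappaE sigma1; apply/deglexP; right; split.
  by rewrite !mdeg_sum; apply: eq_bigr => i _; rewrite !mdeg1.
have [i0 i0P i0_min] : exists2 i0, sigma i0 != i0 & forall i, sigma i != i -> (i0 <= i)%N.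
  have [i1 Pi1] : exists i, sigma i != i.
    apply/existsP; apply: contraNT sigma1 => /existsPn sigma_id.
    by apply/eqP/permP => i; rewrite perm1; apply/eqP; rewrite -[_ == _]negbK.
  by case: (@arg_minnP _ i1 (fun i => sigma i != i) (@nat_of_ord s) Pi1) => i0; exists i0.
have fix_lt (i : 'I_s) : (i < i0)%N -> sigma i = i.
  by move=> lt_i; apply/eqP; apply: contraTT lt_i => /i0_min; rewrite -leqNgt.
have ge_i0 (i : 'I_s) : (i0 <= i)%N -> (i0 <= sigma i)%N.
  move=> le_i; rewrite leqNgt; apply/negP => lt_si.
  have /perm_inj si := fix_lt _ lt_si; by rewrite si ltnNge le_i in lt_si.
have f_ge (i : 'I_s) : (i0 <= i)%N -> (f i0 <= f i)%N.
  by rewrite leq_eqVlt => /predU1P[/val_inj ->//|/f_homo/ltnW].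
have c_ge (i : 'I_s) : (i0 <= i)%N -> (i0 * c <= i * c)%N.
  by move=> le_i; rewrite leq_mul2r le_i orbT.
exists (kappa i0 i0); split=> [k lt_k|].
  rewrite !mnm_sumE; apply: eq_bigr => i _; rewrite !mnm1E.
  have [lt_i|le_i] := ltnP i i0; first by rewrite fix_lt.
  have gt_k (j : 'I_s) : (i0 <= j)%N -> (kappa i j == k) = false.
    move=> le_j; apply/negbTE; rewrite -val_eqE /= neq_ltn; apply/orP; right.
    by apply: leq_trans lt_k _; rewrite !kappaE leq_add ?f_ge ?c_ge.
  by rewrite !gt_k ?ge_i0.
rewrite !mnm_sumE [X in (_ < X)%N](bigD1 i0) // [X in (X < _)%N](bigD1 i0) //=.
have lt_si : (i0 < sigma i0)%N by rewrite ltn_neqAle eq_sym i0P ge_i0.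
rewrite !mnm1E eqxx -val_eqE /= !kappaE eqn_add2r (gtn_eqF (f_homo _ _ lt_si)).
rewrite add0n add1n ltnS leq_sum // => i neq_i; rewrite !mnm1E.
have [lt_i|le_i] := ltnP i i0; first by rewrite fix_lt.
have lt_i : (i0 < i)%N by rewrite ltn_neqAle eq_sym neq_i.
suff -> : (kappa i (sigma i) == kappa i0 i0) = false by [].
apply/negbTE; rewrite -val_eqE /= neq_ltn !kappaE; apply/orP; right.
by rewrite -addnS leq_add ?f_ge ?ge_i0 // ltn_mul2r c_gt0.
Qed.

Lemma det_var_mx_lead s (f : 'I_s -> nat) (kappa : 'I_s -> 'I_s -> 'I_n) :
    {homo f : i j / (i < j)%N} -> (forall i j, kappa i j = f j + i * c :> nat)%N ->
  \det (var_mx kappa) != 0 /\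
  mlead (\det (var_mx kappa)) = (\sum_i U_(kappa i i))%MM.
Proof.
move=> f_homo kappaE; set m := (\sum_i _)%MM.
have detE : \det (var_mx kappa)
    = \sum_(sigma : 'S_s) (-1) ^+ sigma * 'X_[\sum_i U_(kappa i (sigma i))].
  apply: eq_bigr => sigma _; rewrite -mprodXE; congr (_ * _).
  by apply: eq_bigr => i _; rewrite mxE.
have coefE w : (\det (var_mx kappa))@_w
    = \sum_(sigma : 'S_s) (-1) ^+ sigma * ((\sum_i U_(kappa i (sigma i)))%MM == w)%:R.
  rewrite detE raddf_sum; apply: eq_bigr => sigma _ /=.
  by rewrite -mcoeffX; case: odd_perm; rewrite ?mulN1r ?mul1r ?mcoeffN.
have lead1 : (\det (var_mx kappa))@_m = 1.
  rewrite coefE (bigD1 (1%g : 'S_s)) //= odd_perm1 mul1r.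
  rewrite [X in _ + X]big1 => [|sigma sigma1].
    by rewrite addr0; under eq_bigr do rewrite perm1; rewrite eqxx.
  by rewrite (lt_eqF (diagonal_lt f_homo kappaE sigma1)) mulr0.
have m_supp : m \in msupp (\det (var_mx kappa)).
  by rewrite mcoeff_msupp lead1 oner_eq0.
have det0 : \det (var_mx kappa) != 0.
  by apply: contraTneq m_supp => ->; rewrite msupp0.
split=> //; apply: le_anti; rewrite msupp_le_mlead // andbT leNgt.
apply/negP => lt_m; move: (mlead_supp det0); rewrite mcoeff_msupp coefE.
rewrite big1 ?eqxx // => sigma _; have [->|sigma1] := eqVneq sigma 1%g.
  by under eq_bigr do rewrite perm1; rewrite (lt_eqF lt_m) mulr0.
by rewrite (lt_eqF (lt_trans (diagonal_lt f_homo kappaE sigma1) lt_m)) mulr0.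
Qed.

Lemma nth_c_chain (x0 : 'I_n) (a : seq 'I_n) i j :
  c_chain c a -> (i <= j < size a)%N -> (nth x0 a i + (j - i) * c.+1 <= nth x0 a j)%N.
Proof.
move=> /(sortedP x0) gap; elim: j => [|j IH] /andP[le_ij lt_j].
  by move: le_ij; rewrite leqn0 => /eqP ->; rewrite subnn addn0.
move: le_ij; rewrite leq_eqVlt => /predU1P[->|le_ij]; first by rewrite subnn addn0.
have := IH; rewrite -ltnS le_ij ltnW // => /(_ isT) le_j.
by have := gap j lt_j; rewrite subSn //; lia.
Qed.

Lemma chain_minorE (a : seq 'I_n) : c_chain c a ->
  exists f : 'I_(size a) -> 'I_(n - (size a).-1 * c),
  [/\ {homo f : i j / (i < j)%N},
      forall i, (f i + i * c = tnth (in_tuple a) i)%N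
    & chain_minor K c a = \det (colsub f (hankel K n c (size a)))].
Proof.
move=> ca; rewrite /chain_minor.
have gap (i j : 'I_(size a)) : (i <= j)%N ->
    (tnth (in_tuple a) i + (j - i) * c.+1 <= tnth (in_tuple a) j)%N.
  move=> le_ij; have x0 : 'I_n := tnth (in_tuple a) i.
  rewrite !(tnth_nth x0) /= nth_c_chain //.
  by rewrite le_ij /=.
have diagP (f : 'I_(size a) -> 'I_(n - (size a).-1 * c)) i :
    (hankel K n c (size a) i (f i) == 'X_(tnth (in_tuple a) i)) =
    (f i + i * c == tnth (in_tuple a) i)%N.
  rewrite mxE; apply/eqP/eqP => [/(congr1 (@mlead n K))|eq_f].
    by rewrite !mleadXm => /eqP; rewrite eq_mnm1 => /eqP <-.
  by congr 'X_[U_(_)]; apply: val_inj.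
case: pickP => [f /forallP diag_f|no_f].
  have fE i : (f i + i * c = tnth (in_tuple a) i)%N by apply/eqP; rewrite -diagP.
  exists f; split=> // i j lt_ij; have := gap i j (ltnW lt_ij).
  by rewrite -!fE; nia.
(* This rules out the default value 0: the columns a_i - i * c exist, by comparing a_i with the
   first element of the chain for the lower bound and with the last one for the upper bound. *)
have bound (i : 'I_(size a)) :
    (i * c <= tnth (in_tuple a) i)%N /\
    (tnth (in_tuple a) i - i * c < n - (size a).-1 * c)%N.
  have s_gt0 : (0 < size a)%N by exact: leq_ltn_trans (leq0n i) (ltn_ord i).
  have last_lt : ((size a).-1 < size a)%N by rewrite prednK.
  have := gap (Ordinal s_gt0) i (leq0n i).
  have le_il : (i <= (size a).-1)%N by rewrite -ltnS prednK.
  have := gap i (Ordinal last_lt) le_il.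
  have := ltn_ord (tnth (in_tuple a) (Ordinal last_lt)).
  move: le_il; rewrite /= subn0; nia.
have := no_f [ffun i => Ordinal (bound i).2]; rewrite /= => /forallP[] i.
by rewrite diagP ffunE /= subnK // (bound i).1.
Qed.

Lemma colsub_hankelE s (f : 'I_s -> 'I_(n - s.-1 * c)) :
  colsub f (hankel K n c s) = var_mx (fun i j => Ordinal (hankel_subproof i (f j))).
Proof. by apply/matrixP => i j; rewrite !mxE. Qed.

Lemma chain_minor_lead (a : seq 'I_n) : c_chain c a ->
  chain_minor K c a != 0 /\ mlead (chain_minor K c a) = chain_mnm a.
Proof.
move=> /chain_minorE[f [f_homo fE ->]]; rewrite colsub_hankelE.
have [] := @det_var_mx_lead _ (fun j => f j)
  (fun i j => Ordinal (hankel_subproof i (f j))) => //.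
move=> det0 ->; split=> //; rewrite /chain_mnm (big_tnth _ _ a).
by apply: eq_bigr => i _; congr mnm1; apply: val_inj; rewrite /= fE.
Qed.

Lemma chain_minors_lead (d : 'X_{1..n}) (l : seq (seq 'I_n)) : c_decomposition c d l ->
  chain_minors K c l != 0 /\ mlead (chain_minors K c l) = d.
Proof.
move=> dl; rewrite (c_decomposition_mnm dl) /chain_minors.
have cl a : a \in l -> c_chain c a by move=> /(c_decomposition_chain dl)[].
elim: l {dl} cl => [|a l IH] cl; first by rewrite !big_nil oner_neq0 mlead1.
have [a0 lead_a] := chain_minor_lead (cl a (mem_head _ _)).
have [|l0 lead_l] := IH; first by move=> b bl; apply: cl; rewrite inE bl orbT.
by rewrite !big_cons mulf_neq0 // mleadM // lead_a lead_l.
Qed.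

End HankelMinors.

(** A zero column added to [P] and a zero row added to [Q] make both square. The size is given by an
    equation so that [T + 1] fits as well. *)
Lemma det_mulmx_thin (A : idomainType) m T (P : 'M[A]_(m, T)) (Q : 'M[A]_(T, m)) :
  m = T.+1 -> \det (P *m Q) = 0.
Proof.
move=> eq_m; subst m.
pose P' : 'M[A]_T.+1 := \matrix_(i, j) if unlift ord_max j is Some l then P i l else 0.
pose Q' : 'M[A]_T.+1 := \matrix_(i, j) if unlift ord_max i is Some l then Q l j else 0.
have -> : P *m Q = P' *m Q'.
  have P'0 i : P' i ord_max = 0 by rewrite mxE unlift_none.
  apply/matrixP => i j; rewrite mxE [RHS]mxE (bigD1_ord ord_max) //= P'0.
  by rewrite mul0r add0r; apply: eq_bigr => l _; rewrite !mxE !liftK.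
rewrite det_mulmx (expand_det_col P' ord_max) big1 ?mul0r // => i _.
by rewrite mxE unlift_none mul0r.
Qed.

(* Multiplying the block matrix on the right by a suitable block matrix of
   determinant (det P)^k clears its upper right block. *)
Lemma det_schur (A : comNzRingType) m k (P : 'M[A]_m) (Q : 'M[A]_(m, k))
    (R : 'M[A]_(k, m)) (S : 'M[A]_k) :
  \det (block_mx P Q R S) * \det P ^+ k =
  \det P * \det (\det P *: S - R *m \adj P *m Q).
Proof.
rewrite -(det_scalar k) -[X in _ * X = _]mul1r -(det1 A m).
rewrite -(det_ublock _ (- (\adj P *m Q))) -det_mulmx mulmx_block.
rewrite !mulmx1 !mulmx0 !addr0 !mulmxN mulmxA mul_mx_adj mul_scalar_mx.
rewrite !mul_mx_scalar addNr mulmxA [- _ + _]addrC.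
by rewrite det_lblock.
Qed.

(** * Values of minors at the generic point, and powers of the ideal *)

Section HankelIdeals.
Variables (K : fieldType) (n c : nat).
Hypothesis c_gt0 : (0 < c)%N.

Local Notation var_mx kappa := (var_mx K kappa).

(** Expansion along the last row leaves minors on the first rows, which have the same shape, until
    size t is reached. There the last row, whose indices are below [n], shows that the columns fit
    into X_t. *)
Lemma big_minor_hankel_ideal t u (f : 'I_u -> nat) (kappa : 'I_u -> 'I_u -> 'I_n) :
    (0 < t <= u)%N -> {homo f : i j / (i < j)%N} ->
    (forall i j, kappa i j = f j + i * c :> nat)%N ->
  hankel_ideal K n c t (\det (var_mx kappa)).
Proof.
elim: u f kappa => [|u IH] f kappa /andP[t_gt0 le_tu] f_homo kappaE; first by lia.
move: le_tu; rewrite leq_eqVlt => /predU1P[eq_t|lt_tu].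
  subst t; have lt_f j : (f j < n - u * c)%N.
    by rewrite ltn_subRL addnC -(kappaE ord_max j).
  apply: ideal_gen_sub; exists (fun j => Ordinal (lt_f j)); first exact: f_homo.
  congr (\det _); apply/matrixP => i j; rewrite !mxE.
  by congr 'X_[U_(_)]; apply: val_inj; rewrite /= kappaE.
have [_ _ absorb] := ideal_gen_ideal (fun p => exists2 f : 'I_t -> 'I_(n - t.-1 * c),
    {homo f : i j / (i < j)%N} & p = \det (colsub f (hankel K n c t))).
rewrite (expand_det_row _ ord_max); apply: ideal_sum => [|j].
  exact: ideal_gen_ideal.
rewrite /cofactor mulrA; apply: absorb.
have -> : row' ord_max (col' j (var_mx kappa)) =
    var_mx (fun i k => kappa (lift ord_max i) (lift j k)).
  by apply/matrixP => i k; rewrite !mxE.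
apply: (IH (f \o lift j)) => [|i k lt_ik|i k]; first by rewrite t_gt0.
  by apply: f_homo; rewrite /= /bump; case: leqP; case: leqP; lia.
by rewrite kappaE lift_max.
Qed.

Variables (T : nat) (p : generic_point K n c T).

Local Notation I := (hankel_ideal K n c T.+1).
Local Notation red f := (gp_red p (gp_eval p f)).

Lemma gp_zMn l j i : gp_z p l (j + i * c) = gp_w p l ^+ i * gp_z p l j.
Proof.
elim: i => [|i IH]; first by rewrite addn0 mul1r.
by rewrite mulSn addnCA addnC gp_zD IH exprS mulrA.
Qed.

(** At p the matrix is a sum of T matrices of rank one, hence a product through dimension T. The row
    shifts [r] are arbitrary, to include bordered minors. *)
Lemma red_minor m (r f : 'I_m -> nat) (kappa : 'I_m -> 'I_m -> 'I_n) :
    m = T.+1 -> (forall i j, kappa i j = f j + r i * c :> nat)%N ->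
  red (\det (var_mx kappa)) = 0.
Proof.
move=> eq_m kappaE; rewrite -!det_map_mx /=.
pose P := \matrix_(i < m, l < T) gp_w p l ^+ r i.
pose Q := \matrix_(l < T, j < m) gp_z p l (f j).
rewrite -(det_mulmx_thin P Q eq_m); congr (\det _); apply/matrixP => i j.
rewrite !mxE gp_evalX; apply: eq_bigr => l _.
by rewrite !mxE kappaE gp_zMn.
Qed.

Lemma hankel_ideal_red f : I f -> red f = 0.
Proof.
move: f; apply: ideal_gen_min => [|_ [f f_homo ->]].
  split=> [|f g f0 g0|r f f0]; first by rewrite !rmorph0.
    by rewrite !rmorphD f0 g0 addr0.
  by rewrite !rmorphM f0 mulr0.
by rewrite colsub_hankelE (@red_minor _ (@nat_of_ord _) (fun j => f j)).
Qed.

(** The T windows starting at the diagonal entries cover the whole leading monomial, so [gp_lead]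
    excludes divisibility by eps. *)
Lemma small_minor_red m (f : 'I_m -> nat) (kappa : 'I_m -> 'I_m -> 'I_n) :
    m = T -> {homo f : i j / (i < j)%N} ->
    (forall i j, kappa i j = f j + i * c :> nat)%N ->
  red (\det (var_mx kappa)) != 0.
Proof.
move=> eq_m f_homo kappaE; apply/eqP => /gp_redP[y eval_det].
have [det0 lead_det] := det_var_mx_lead K c_gt0 f_homo kappaE.
have := @gp_lead _ _ _ _ p _ [seq val (kappa i i) | i <- enum 'I_m] 1 y det0.
rewrite size_map size_enum_ord expr1 => /(_ eq_m eval_det).
rewrite big1 // => x; apply: contraNeq; rewrite lead_det mnm_sumE sum_nat_eq0.
move=> /forallPn[i]; rewrite /= mnm1E eqb0 negbK => /eqP <-.
apply/hasP; exists (val (kappa i i)); last by rewrite leqnn leq_addr.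
by apply/mapP; exists i; rewrite ?mem_enum.
Qed.

Hypothesis redI : forall f, red f = 0 -> I f.

Lemma chain_minor_ideal_pow u (f : 'I_u -> nat) (kappa : 'I_u -> 'I_u -> 'I_n) :
    (T <= u)%N -> {homo f : i j / (i < j)%N} ->
    (forall i j, kappa i j = f j + i * c :> nat)%N ->
  exists2 h, ~ I h & ideal_pow I (u - T) (h * \det (var_mx kappa)).
Proof.
move=> le_Tu; move: (u - T)%N (subnKC le_Tu) => k eq_u; subst u.
move=> f_homo kappaE {le_Tu}.
pose P := ulsubmx (var_mx kappa); pose Q := ursubmx (var_mx kappa).
pose R := dlsubmx (var_mx kappa); pose S := drsubmx (var_mx kappa).
have PE : P = var_mx (fun i j => kappa (lshift k i) (lshift k j)).
  by apply/matrixP => i j; rewrite !mxE.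
have redP0 : red (\det P) != 0.
  rewrite PE; apply: (@small_minor_red _ (f \o lshift k)) => // i j lt_ij.
  exact: f_homo.
have P0 : \det P != 0 by apply: contraNneq redP0 => ->; rewrite !rmorph0.
exists (\det P ^+ k).
  by move=> /hankel_ideal_red/eqP; rewrite !rmorphXn expf_eq0 (negbTE redP0) andbF.
rewrite mulrC -[var_mx kappa]submxK det_schur -/P -/Q -/R -/S.
have [_ _ absorb] := ideal_pow_ideal I k; apply/absorb/det_ideal_pow => i j.
apply: redI.
(* This is the Schur identity for a border of width 1, after cancelling the nonzero factor
   [\det P]. *)
have -> : (\det P *: S - R *m \adj P *m Q) i j =
    \det (block_mx P (col j Q) (row i R) (S i j)%:M).
  have := det_schur P (col j Q) (row i R) (S i j)%:M.
  rewrite expr1 => bordered; apply: (mulfI P0); rewrite [RHS]mulrC {}bordered.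
  congr (_ * _); rewrite det_mx11 mxE [RHS]mxE; congr (_ + _).
    by rewrite mxE [RHS]mxE [_%:M _ _]mxE eqxx mulr1n.
  rewrite mxE [RHS]mxE; congr (- _).
  rewrite -mulmxA -[in RHS]mulmxA mxE [RHS]mxE; apply: eq_bigr => l _.
  rewrite [row i R _ _]mxE; congr (_ * _).
  by rewrite mxE [RHS]mxE; apply: eq_bigr => l' _; rewrite [col j Q _ _]mxE.
pose F (j' : 'I_(T + 1)) := match split j' with
  inl l => lshift k l | inr _ => rshift T j end.
pose G (i' : 'I_(T + 1)) := match split i' with
  inl l => lshift k l | inr _ => rshift T i end.
have -> : block_mx P (col j Q) (row i R) (S i j)%:M =
    var_mx (fun i' j' => kappa (G i') (F j')).
  apply/matrixP => i' j'; rewrite !mxE /F /G.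
  by case: (split i') => l; rewrite !mxE; case: (split j') => l';
    rewrite !mxE ?ord1 ?eqxx ?mulr1n.
by apply: (@red_minor _ (fun i => G i) (fun j => f (F j))) => [|i' j'];
  rewrite ?addn1 ?kappaE.
Qed.

End HankelIdeals.

(** * The symbolic powers of the ideals of minors *)

Section SymbolicPowers.
Variables (K : fieldType) (n c : nat).
Hypothesis c_gt0 : (0 < c)%N.
Implicit Types (f g : {mpoly K[n]}) (l : seq (seq 'I_n)).

(** A standard monomial is determined by its leading monomial, through the unique decomposition of
    the latter. Hence the largest leading monomial with nonzero coefficient cannot cancel. *)
Lemma standard_monomial_lin_indep (P : seq (seq 'I_n) -> Prop) :
  lin_indep (standard_monomial_with (K := K) (n := n) c P).
Proof.
move=> k a g g_inj std_g sum0 i; apply/eqP/negPn/negP => ai0.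
case: (@arg_maxP _ _ _ i (fun j => a j != 0) (fun j => mlead (g j)) ai0) => j aj0 j_max.
have lead_g i1 : exists2 l, c_decomposition c (mlead (g i1)) l &
    g i1 = chain_minors K c l /\ g i1 != 0.
  have [d [l [dl _ g_eq]]] := std_g i1; exists l.
    by rewrite g_eq (chain_minors_lead K c_gt0 dl).2.
  by rewrite g_eq; split=> //; case: (chain_minors_lead K c_gt0 dl).
have [l dl [gj gj0]] := lead_g j.
have := congr1 (mcoeff (mlead (g j))) sum0; rewrite raddf_sum mcoeff0 (bigD1 j) //=.
rewrite mcoeffZ big1 ?addr0 => [/eqP|i1 neq_i].
  by rewrite mulf_eq0 (negbTE aj0) mleadc_eq0 (negbTE gj0).
rewrite mcoeffZ; have [->|ai1] := eqVneq (a i1) 0; first by rewrite mul0r.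
rewrite mcoeff_gt_mlead ?mulr0 // lt_neqAle [X in _ && X](j_max _ ai1) andbT.
apply: contraNneq neq_i => eq_lead; apply/eqP/g_inj.
have [l1 dl1 [-> _]] := lead_g i1; rewrite gj.
by rewrite eq_lead in dl1; rewrite (c_decomposition_unique dl dl1).
Qed.

Variables (T : nat) (p : generic_point K n c T).

Local Notation I := (hankel_ideal K n c T.+1).
Local Notation red f := (gp_red p (gp_eval p f)).
Local Notation std s :=
  (standard_monomial_with (K := K) (n := n) c (fun l => (s <= gamma T.+1 l)%N)).

Definition vanishes_to_order s f := exists y, gp_eval p f = gp_eps p ^+ s * y.
Local Notation W := vanishes_to_order.

Lemma vanishing_lead s f : W s f -> f != 0 ->
  exists2 l, c_decomposition c (mlead f) l & (s <= gamma T.+1 l)%N.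
Proof.
move=> [y eval_f] f0; have [l dl] := c_decomposition_exists c (mlead f).
have [bs sz_bs le_bs] := decomposition_windows T dl.
by exists l => //; apply: leq_trans le_bs; apply: gp_lead f0 sz_bs eval_f.
Qed.

Lemma vanishingB s a f g : W s f -> W s g -> W s (f - a *: g).
Proof.
move=> [y eval_f] [z eval_g]; exists (y - gp_eval p a%:MP * z).
by rewrite -mul_mpolyC rmorphB rmorphM /= eval_f eval_g mulrBr mulrCA.
Qed.

(** Subtracting a multiple of the standard monomial with the same leading monomial as f lowers the
    leading monomial. That standard monomials lie in [W s] is a premise because it is obtained from
    [I] for s = 1, and from the symbolic power in general. *)
Lemma vanishing_ind s (P : {mpoly K[n]} -> Prop) :
    (forall g, std s g -> W s g) -> P 0 ->
    (forall a f g, std s g -> P f -> P (f + a *: g)) ->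
  forall f, W s f -> P f.
Proof.
move=> stdW P0 PD f; elim/mleadrect: f => f IH Wf.
have [->//|f0] := eqVneq f 0.
have [l dl gam_l] := vanishing_lead Wf f0.
have [g0 lead_g] := chain_minors_lead K c_gt0 dl.
set g := chain_minors K c l in g0 lead_g.
have std_g : std s g by exists (mlead f), l.
pose a := mleadc f / mleadc g; pose h := f - a *: g.
have -> : f = h + a *: g by rewrite subrK.
apply: PD => //; have [->//|h0] := eqVneq h 0.
apply: IH; last exact: vanishingB Wf (stdW g std_g).
rewrite lt_neqAle; apply/andP; split.
  apply: contraNneq h0 => eq_lead; rewrite -mleadc_eq0 eq_lead mcoeffB mcoeffZ.
  by rewrite /a lead_g divfK ?subrr // -lead_g mleadc_eq0.
apply: le_trans (mleadB_le _ _) _; rewrite leUx lexx /=.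
by rewrite (le_trans (mleadZ_le _ _)) ?lead_g.
Qed.

Lemma standard_monomial_ideal g : std 1 g -> I g.
Proof.
case=> d [l [dl gam_l ->]].
have [a a_l lt_a] : exists2 a, a \in l & (T < size a)%N.
  apply/hasP; apply: contraTT gam_l => /hasPn small; rewrite -leqNgt leqn0.
  rewrite /gamma big_seq big1 // => a /small; rewrite -leqNgt => le_a.
  by apply/eqP; rewrite subn_eq0.
have [f [f_homo fE minor_a]] := chain_minorE K c_gt0 (c_decomposition_chain dl a_l).1.
have [_ _ absorb] : is_ideal I by exact: ideal_gen_ideal.
rewrite /chain_minors (big_rem a a_l) [X in hankel_ideal _ _ _ _ X]mulrC; apply: absorb.
rewrite minor_a colsub_hankelE.
exact: (big_minor_hankel_ideal K c_gt0 (t := T.+1) (f := fun j => f j)).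
Qed.

(** Vanishing at p means divisibility by eps, so [vanishing_ind] applies with s = 1. Being the
    kernel of a map to a domain, [I] is then prime. *)
Lemma red_eq0P f : red f = 0 <-> I f.
Proof.
have [I0 ID absorb] : is_ideal I by exact: ideal_gen_ideal.
split; last exact: hankel_ideal_red.
move=> /gp_redP[y eval_f]; apply: (@vanishing_ind 1 I) => //; last first.
- by exists y; rewrite expr1.
- move=> a f' g /standard_monomial_ideal Ig If'.
  by rewrite -mul_mpolyC; apply: ID => //; apply: absorb.
move=> g /standard_monomial_ideal/(hankel_ideal_red p)/gp_redP[z eval_g].
by exists z; rewrite expr1.
Qed.

Lemma hankel_ideal_prime f g : ~ I f -> ~ I g -> ~ I (f * g).
Proof.
move=> If Ig /red_eq0P/eqP; rewrite !rmorphM mulf_eq0.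
by move=> /orP[] /eqP/red_eq0P.
Qed.

Lemma hankel_ideal_proper : ~ I 1.
Proof. by move=> /red_eq0P/eqP; rewrite !rmorph1 oner_eq0. Qed.

Lemma symbolic_hankelP s f :
  symbolic_power I s f <-> exists2 h, ~ I h & ideal_pow I s (h * f).
Proof.
apply: symbolic_powerP.
- exact: ideal_gen_ideal.
- exact: hankel_ideal_prime.
- exact: hankel_ideal_proper.
Qed.

Lemma standard_monomial_symbolic s g : std s g -> symbolic_power I s g.
Proof.
case=> d [l [dl gam_l ->]]; apply/symbolic_hankelP.
suff [h Ih pow_h] : exists2 h, ~ I h &
    ideal_pow I (gamma T.+1 l) (h * chain_minors K c l).
  by exists h => //; apply: ideal_pow_leq pow_h.
have cl a : a \in l -> c_chain c a by move=> /(c_decomposition_chain dl)[].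
rewrite /gamma /chain_minors; elim: l {d dl gam_l} cl => [|a l IH] cl.
  by exists 1; [exact: hankel_ideal_proper | rewrite !big_nil; exact: ideal_pow0].
have [|h Ih pow_h] := IH; first by move=> b bl; apply: cl; rewrite inE bl orbT.
have [h' Ih' pow_h'] : exists2 h', ~ I h' &
    ideal_pow I ((size a).+1 - T.+1) (h' * chain_minor K c a).
  rewrite subSS; have [le_Ta|lt_aT] := leqP T (size a); last first.
    rewrite (eqP (ltnW lt_aT : _ - _ == 0)%N).
    by exists 1; [exact: hankel_ideal_proper | exact: ideal_pow0].
  have [f [f_homo fE ->]] := chain_minorE K c_gt0 (cl a (mem_head _ _)).
  rewrite colsub_hankelE.
  apply: (@chain_minor_ideal_pow _ _ _ c_gt0 _ p _ _ (fun j => f j)) => // f'.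
  by move/red_eq0P.
exists (h' * h); first exact: hankel_ideal_prime.
by rewrite !big_cons mulrACA; apply: ideal_powM.
Qed.

Lemma vanishing_pow s f : ideal_pow I s f -> W s f.
Proof.
move: f; apply: ideal_gen_min => [|_ [F IF ->]].
  split=> [|f g [y eval_f] [z eval_g]|r f [y eval_f]].
  - by exists 0; rewrite rmorph0 mulr0.
  - by exists (y + z); rewrite rmorphD eval_f eval_g mulrDr.
  - by exists (gp_eval p r * y); rewrite rmorphM eval_f mulrCA.
elim: s F IF => [|s IH] F IF; first by exists 1; rewrite big_ord0 rmorph1 mulr1.
have [y eval_F] := IH (F \o lift ord0) (fun i => IF _).
have /red_eq0P/gp_redP[z eval_F0] := IF ord0.
exists (z * y); rewrite big_ord_recl rmorphM eval_F0 [X in _ * X]eval_F exprS.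
by rewrite mulrACA.
Qed.

(** As eps generates the kernel of a map to a domain and does not divide [h], its powers can be
    split off [x] one at a time. *)
Lemma gp_eps_cancel s (h x y : gp_ring p) : gp_red p h != 0 ->
  h * x = gp_eps p ^+ s * y -> exists y', x = gp_eps p ^+ s * y'.
Proof.
move=> h0; elim: s x y => [|s IH] x y; first by exists x; rewrite mul1r.
rewrite exprS -mulrA => hx.
have : gp_red p (h * x) = 0 by apply/gp_redP; exists (gp_eps p ^+ s * y).
move=> /eqP; rewrite rmorphM mulf_eq0 (negbTE h0) => /eqP/gp_redP[x' x_eq].
have [|y' x'_eq] := IH x' y.
  by apply: (mulfI (gp_eps_neq0 p)); rewrite -hx x_eq mulrCA.
by exists y'; rewrite x_eq x'_eq mulrA.
Qed.

Lemma symbolic_vanishing s f : symbolic_power I s f -> W s f.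
Proof.
move=> /symbolic_hankelP[h Ih /vanishing_pow[y]]; rewrite rmorphM => eval_hf.
by apply: gp_eps_cancel eval_hf; apply/eqP => /red_eq0P.
Qed.

Lemma standard_monomial_vanishing s g : std s g -> W s g.
Proof. by move=> /standard_monomial_symbolic/symbolic_vanishing. Qed.

Lemma symbolic_hankel_ideal s : is_ideal (symbolic_power I s).
Proof.
apply: symbolic_power_ideal.
- exact: ideal_gen_ideal.
- exact: hankel_ideal_prime.
- exact: hankel_ideal_proper.
Qed.

Lemma symbolic_hankel_basis s : is_basis (std s) (symbolic_power I s).
Proof.
split=> [|f]; first exact: standard_monomial_lin_indep.
have [sym0 symD absorb] := symbolic_hankel_ideal s.
split=> [/symbolic_vanishing|[k [a [g [std_g ->]]]]]; last first.
  apply: ideal_sum => [|i]; first exact: symbolic_hankel_ideal.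
  by rewrite -mul_mpolyC; apply: absorb; apply: standard_monomial_symbolic.
move: f; apply: vanishing_ind.
- exact: standard_monomial_vanishing.
- by exists 0%N, (fun=> 0), (fun=> 0); split=> [[]|] //; rewrite big_ord0.
move=> a _ g std_g [k [b [h [std_h ->]]]].
exists k.+1, (oapp b a \o unlift ord0), (oapp h g \o unlift ord0); split=> [i|].
  by rewrite /=; case: unlift => [j|] /=.
rewrite big_ord_recl /= unlift_none addrC /=; congr (_ + _).
by apply: eq_bigr => i _; rewrite liftK.
Qed.

(** Each factor has size at least t and so contributes at least 1 to [gamma]: there are at most s
    factors, each given by a chain of at most [n] elements. *)
Lemma groebner_set_finite s :
  exists r : seq {mpoly K[n]}, forall g, groebner_set c T.+1 s g -> g \in r.
Proof.
exists [seq chain_minors K c [seq val a | a <- val l] | l : s.-bseq (n.-bseq 'I_n)].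
move=> _ [d [l [dl [big_l gam_l] ->]]].
have sz_l : (size l <= s)%N.
  rewrite -gam_l /gamma -sum1_size !big_seq leq_sum // => a al.
  by have := allP big_l a al; lia.
pose l' := [seq insub_bseq n a | a <- l].
have sz_l' : (size l' <= s)%N by rewrite size_map.
apply/mapP; exists (Bseq sz_l'); first by rewrite mem_enum.
congr chain_minors; rewrite /= -map_comp map_id_in // => a al /=.
rewrite /insub_bseq insubdK // unfold_in /=; apply: (@c_chain_size n c).
by case: (c_decomposition_chain dl al).
Qed.

(** By [vanishing_lead], the leading monomial of a nonzero element has [gamma] at least s. Trimming
    its decomposition yields a divisor that is the leading monomial of an element of
    [groebner_set]. *)
Lemma symbolic_hankel_groebner s :
  groebner_basis (groebner_set c T.+1 s) (symbolic_power I s).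
Proof.
have G_sym g : groebner_set c T.+1 s g -> symbolic_power I s g.
  move=> [d [l [dl [_ gam_l] ->]]]; apply: standard_monomial_symbolic.
  by exists d, l; split; rewrite ?gam_l.
split=> //; first exact: groebner_set_finite.
split; (apply: ideal_gen_min => [|_ [g [gI g0] ->]]; first exact: ideal_gen_ideal).
  have [l dl gam_l] := vanishing_lead (symbolic_vanishing gI) g0.
  have [d' [l' [dl' le_d' big_l' gam_l']]] := trim_decomposition dl gam_l.
  have [_ _ absorb] : is_ideal (initial_ideal (groebner_set (K := K) (n := n) c T.+1 s)).
    exact: ideal_gen_ideal.
  rewrite -(submK le_d') mpolyXD; apply/absorb/ideal_gen_sub.
  have [h0 lead_h] := chain_minors_lead K c_gt0 dl'.
  by exists (chain_minors K c l'); rewrite ?lead_h //; split=> //; exists d', l'.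
by apply: ideal_gen_sub; exists g => //; split=> //; apply: G_sym.
Qed.

End SymbolicPowers.

Local Close Scope ring_scope.

Theorem corollary3p21 (K : fieldType) (n c t s : nat)
    (hn : 1 <= n) (hc : 1 <= c) (ht : 1 <= t <= (n + c) %/ (c + 1)) :
  let It_s := symbolic_power (hankel_ideal K n c t) s in
  [/\ ideal_of_standard_monomials c It_s,
      is_basis
        (standard_monomial_with c (fun l => s <= gamma t l)) It_s
    & groebner_basis (groebner_set c t s) It_s].
Proof.
case: t ht => [//|T] _ It_s; have p := secant_generic_point K n T hc.
have basis := symbolic_hankel_basis hc p s.
split=> //; last exact: (symbolic_hankel_groebner hc p).
split; first exact: (symbolic_hankel_ideal hc p).
eexists; split; last exact: basis.
by move=> f [d [l [dl _ ->]]]; exists d, l.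
Qed.
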